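(* Let $S$ be a smooth surface. The map $\phi\mapsto\Phi=(\phi,\phi_-,\phi_+)$ is a bijection from the set of totally isotropic immersions $\phi:S\to Q=Q_0$ onto the set of integral surfaces $\Phi:S\to\mathcal{I}$ of the distribution $\xi\subset T\mathcal{I}$ (i.e. immersions $\Phi$ with $\mathrm{im}\,T\Phi\subset\xi$) such that $q_0\circ\Phi$ is an immersion; the inverse correspondence is $\Phi\mapsto\phi=q_0\circ\Phi$.
   Context: Let $\mathbb{O}$ be a split octonion algebra over $\mathbb{R}$: the 8-dimensional unital real algebra with multiplicative norm form $N$ of signature $(4,4)$. Left and right multiplications are $L_zx=zx$, $R_zx=xz$. For $z\neq0$ isotropic, $\ker L_z$ and $\ker R_z$ are maximal (4-dimensional) totally isotropic subspaces; every maximal totally isotropic subspace is of exactly one of these two forms with $z$ unique up to scalar, and every 3-dimensional totally isotropic subspace is contained in exactly one of each form. Let $Q\subset P(\mathbb{O})$ be the quadric of isotropic lines. A smooth map $\phi:S\to Q$ is a totally isotropic immersion if it is an immersion and for any local lift $\psi:S\to\mathbb{O}\setminus\{0\}$ the 3-dimensional subspace $V_p=\mathbb{R}\psi(p)+\mathrm{im}\,d\psi(p)$ is totally isotropic for all $p$. Then $\phi_+(p)=[z_+]$, $\phi_-(p)=[z_-]$ are the isotropic lines such that $V_p\subset\ker L_{z_+}$ and $V_p\subset\ker R_{z_-}$; $\phi_\pm$ are smooth. $Q_+$ and $Q_-$ denote the two families of maximal totally isotropic subspaces, $Q_+=\{\ker L_z\}$ and $Q_-=\{\ker R_z\}$,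 each identified with (a copy of) $Q$ via $z$. Put $Q_0=Q$, $Q_1=Q_-$, $Q_2=Q_+$, indices in $\mathbb{Z}/3$, each $Q_i$ being a copy of the quadric of isotropic lines of $\mathbb{O}$. The incidence variety is $$\mathcal{I}=\{([x_i])_{i\in\mathbb{Z}/3}\mid x_ix_{i+1}=0,\ i\in\mathbb{Z}/3\}\subset Q_0\times Q_1\times Q_2,$$ a manifold of dimension 11, with fibrations (projections) $q_i:\mathcal{I}\to Q_i$. For $i\in\mathbb{Z}/3$ let $\xi_i=\ker Tq_{i+1}\cap\ker Tq_{i-1}\subset T\mathcal{I}$, a subbundle of rank 2, and let $\xi=\bigoplus_{i\in\mathbb{Z}/3}\xi_i\subset T\mathcal{I}$, a subbundle of rank 6. *)

(* Defs.v *)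
From HB Require Import structures.
From mathcomp Require Import all_boot all_order all_algebra.
From mathcomp Require Import all_classical all_reals all_analysis.
Set Implicit Arguments.
Unset Strict Implicit.
Unset Printing Implicit Defensive.
Import Order.TTheory GRing.Theory Num.Theory.
Import numFieldNormedType.Exports.
Local Open Scope classical_set_scope.
Local Open Scope ring_scope.

(* On an open set U of a finite-dimensional space this is the usual notion of
   class C^k: f is differentiable and all its directional derivatives are of
   class C^(k-1). *)
Fixpoint Ck_on (R : realType) (V W : normedModType R) (k : nat)
    (U : set V) (f : V -> W) : Prop :=
  match k with
  | 0%N => forall x, U x -> {for x, continuous f}
  | k'.+1 => (forall x, U x -> differentiable f x) /\
             forall v, Ck_on k' U (fun x => 'D_v f x)
  end.

Definition smooth_on (R : realType) (V W : normedModType R)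
    (U : set V) (f : V -> W) : Prop := forall k, Ck_on k U f.

(* A chart is a homeomorphism from cdom onto an open subset of R^2; the values
   of cmap outside cdom, and of cinv outside the image of cdom, are junk. *)
Record chart (R : realType) (S : topologicalType) := Chart {
  cdom : set S;
  cmap : S -> 'rV[R]_2;
  cinv : 'rV[R]_2 -> S;
  cdom_open : open cdom;
  cimg_open : open (cmap @` cdom);
  cmapK : forall p, cdom p -> cinv (cmap p) = p;
  cmap_cont : forall p, cdom p -> {for p, continuous cmap};
  cinv_cont : forall u, (cmap @` cdom) u -> {for u, continuous cinv} }.

Record smooth_surface (R : realType) := SmoothSurface {
  surf_space :> topologicalType;
  atlas : set (chart R surf_space);
  surf_hausdorff : hausdorff_space surf_space;
  surf_second_countable : @second_countable surf_space;
  atlas_cover : forall p, exists2 c, atlas c & cdom c p;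
  atlas_compat : forall c d, atlas c -> atlas d ->
    smooth_on (cmap c @` (cdom c `&` cdom d)) (cmap d \o cinv c) }.

(* The carrier is R^8 (a choice of linear basis); signature (4,4) is expressed
   by the existence of linear coordinates y = x *m P in which the norm is
   y_0^2 + .. + y_3^2 - y_4^2 - .. - y_7^2. *)
Record split_octonion (R : realType) := SplitOctonion {
  omul : 'rV[R]_8 -> 'rV[R]_8 -> 'rV[R]_8;
  oone : 'rV[R]_8;
  onorm : 'rV[R]_8 -> R;
  omul_linear_l : forall y, linear (fun x => omul x y);
  omul_linear_r : forall x, linear (fun y => omul x y);
  omul1l : forall x, omul oone x = x;
  omul1r : forall x, omul x oone = x;
  onorm_signature : exists2 P : 'M[R]_8, P \in unitmx &
    forall x, onorm x =
      \sum_(i < 8 | (i < 4)%N) (x *m P) 0 i ^+ 2 -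
      \sum_(i < 8 | (4 <= i)%N) (x *m P) 0 i ^+ 2;
  onormM : forall x y, onorm (omul x y) = onorm x * onorm y }.

(* Points of P(O) are the elements of {vspace 'rV[R]_8} of dimension 1. *)
Definition quadric (R : realType) (O : split_octonion R) :
    set {vspace 'rV[R]_8} :=
  [set l | \dim l = 1%N /\ forall x, x \in l -> onorm O x = 0].

Definition incidence (R : realType) (O : split_octonion R) :
    set ('Z_3 -> {vspace 'rV[R]_8}) :=
  [set x | (forall i, quadric O (x i)) /\
           forall i a b, a \in x i -> b \in x (i + 1) -> omul O a b = 0].

(* The differential of f at p applied to a tangent vector of S at p, the latter
   being given by its coordinates w in the chart c. *)
Definition sdiff (R : realType) (S : smooth_surface R) (c : chart R S)
    (f : S -> 'rV[R]_8) (p : S) (w : 'rV[R]_2) : 'rV[R]_8 :=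
  'd (f \o cinv c : 'rV[R]_2 -> 'rV[R]_8) (cmap c p) w.

Definition surf_smooth_on (R : realType) (S : smooth_surface R)
    (U : set S) (f : S -> 'rV[R]_8) : Prop :=
  forall c, atlas c -> smooth_on (cmap c @` (cdom c `&` U)) (f \o cinv c).

Definition local_lift (R : realType) (S : smooth_surface R)
    (phi : S -> {vspace 'rV[R]_8}) (U : set S) (psi : S -> 'rV[R]_8) : Prop :=
  [/\ open U, surf_smooth_on U psi &
      forall p, U p -> psi p != 0 /\ phi p = <[psi p]>%VS].

(* Smoothness of a map into P(O), and hence into its submanifold Q.  By the
   same token a map into the submanifold I of P(O)^3 is smooth when its three
   components are. *)
Definition smooth_line_map (R : realType) (S : smooth_surface R)
    (phi : S -> {vspace 'rV[R]_8}) : Prop :=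
  forall p, exists U psi, U p /\ local_lift phi U psi.

(* For x <> 0, the tangent space of P(O) at [x] is O / Rx, the differential of
   O \ 0 -> P(O) at x being the quotient map.  So the differential of a map
   into P(O) is that of a local lift psi, modulo R psi. *)
Definition immersion (R : realType) (S : smooth_surface R)
    (phi : S -> {vspace 'rV[R]_8}) : Prop :=
  smooth_line_map phi /\
  forall p U psi c w, U p -> local_lift phi U psi -> atlas c -> cdom c p ->
    sdiff c psi p w \in <[psi p]>%VS -> w = 0.

Definition immersion3 (R : realType) (S : smooth_surface R)
    (Phi : S -> 'Z_3 -> {vspace 'rV[R]_8}) : Prop :=
  (forall i, smooth_line_map (Phi^~ i)) /\
  forall p U (psi : 'Z_3 -> S -> 'rV[R]_8) c w,
    U p -> (forall i, local_lift (Phi^~ i) U (psi i)) -> atlas c -> cdom c p ->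
    (forall i, sdiff c (psi i) p w \in <[psi i p]>%VS) -> w = 0.

(* R psi(p) + im d psi(p) *)
Definition lift_space (R : realType) (S : smooth_surface R)
    (psi : S -> 'rV[R]_8) (p : S) : set 'rV[R]_8 :=
  [set v | exists c a w,
     [/\ atlas c, cdom c p & v = a *: psi p + sdiff c psi p w]].

Definition tot_isotropic_immersion (R : realType) (O : split_octonion R)
    (S : smooth_surface R) : set (S -> {vspace 'rV[R]_8}) :=
  [set phi | [/\ (forall p, quadric O (phi p)), immersion phi &
     forall U psi p, local_lift phi U psi -> U p ->
       forall v, lift_space psi p v -> onorm O v = 0]].

(* phi_plus p is the isotropic line [z] with V_p contained in ker L_z, and
   phi_minus p the one with V_p contained in ker R_z; the default value 0 (not
   a line) is taken when there is none. *)
Definition phi_plus (R : realType) (O : split_octonion R)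
    (S : smooth_surface R) (phi : S -> {vspace 'rV[R]_8}) (p : S) :
    {vspace 'rV[R]_8} :=
  xget 0%VS [set l | quadric O l /\
    forall z U psi, z \in l -> local_lift phi U psi -> U p ->
      forall v, lift_space psi p v -> omul O z v = 0].

Definition phi_minus (R : realType) (O : split_octonion R)
    (S : smooth_surface R) (phi : S -> {vspace 'rV[R]_8}) (p : S) :
    {vspace 'rV[R]_8} :=
  xget 0%VS [set l | quadric O l /\
    forall z U psi, z \in l -> local_lift phi U psi -> U p ->
      forall v, lift_space psi p v -> omul O v z = 0].

Definition Phi_of (R : realType) (O : split_octonion R)
    (S : smooth_surface R) (phi : S -> {vspace 'rV[R]_8}) (p : S) (i : 'Z_3) :
    {vspace 'rV[R]_8} :=
  if i == 0 then phi p else if i == 1 then phi_minus O phi p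
  else phi_plus O phi p.

Definition q_proj (R : realType) (i : 'Z_3) (x : 'Z_3 -> {vspace 'rV[R]_8}) :
    {vspace 'rV[R]_8} := x i.

(* A tangent vector of P(O)^3 at ([x_i])_i is represented by v : 'Z_3 -> O, with
   v i taken modulo R x_i.  TI x is the inverse image in O^3 of the tangent
   space of I at ([x_i])_i, i.e. of the set of velocities of smooth curves in I
   through that point. *)
Definition TI (R : realType) (O : split_octonion R) (x : 'Z_3 -> 'rV[R]_8) :
    set ('Z_3 -> 'rV[R]_8) :=
  [set v | exists (W : set R^o) (g : 'Z_3 -> R^o -> 'rV[R]_8),
    [/\ open W /\ W 0,
        (forall i, smooth_on W (g i)),
        (forall t, W t -> incidence O (fun i => <[g i t]>%VS)),
        (forall i, g i 0 = x i) &
        (forall i, derive1 (g i) 0 = v i)]].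

Definition ker_Tq (R : realType) (O : split_octonion R) (i : 'Z_3)
    (x : 'Z_3 -> 'rV[R]_8) : set ('Z_3 -> 'rV[R]_8) :=
  [set v | TI O x v /\ v i \in <[x i]>%VS].

Definition xi_ (R : realType) (O : split_octonion R) (i : 'Z_3)
    (x : 'Z_3 -> 'rV[R]_8) : set ('Z_3 -> 'rV[R]_8) :=
  ker_Tq O (i + 1) x `&` ker_Tq O (i - 1) x.

Definition xi (R : realType) (O : split_octonion R)
    (x : 'Z_3 -> 'rV[R]_8) : set ('Z_3 -> 'rV[R]_8) :=
  [set v | exists w : 'Z_3 -> 'Z_3 -> 'rV[R]_8,
    (forall i, xi_ O i x (w i)) /\ forall j, v j = \sum_i w i j].

Definition integral_surface (R : realType) (O : split_octonion R)
    (S : smooth_surface R) : set (S -> 'Z_3 -> {vspace 'rV[R]_8}) :=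
  [set Phi | [/\ (forall p, incidence O (Phi p)), immersion3 Phi &
     forall p U (psi : 'Z_3 -> S -> 'rV[R]_8) c w,
       U p -> (forall i, local_lift (Phi^~ i) U (psi i)) ->
       atlas c -> cdom c p ->
       xi O (fun i => psi i p) (fun i => sdiff c (psi i) p w)]].

(* Main.v *)
(* Let x be a local lift of phi, with partial derivatives x_1, x_2, so that
   V = span (x, x_1, x_2).  For isotropic V the vector
     y = x^* (x_1 (x_2^* u)),  where ^* is the octonion conjugation,
   is annihilated by V from the left.  If w pairs to 1 with an isotropic v and
   is orthogonal to a subspace W of v^perp, multiplication by v maps the common
   right annihilator of W onto that of the conjugates of W and v; rank-nullity,
   applied to the flag V, then gives that the annihilator of V is a line, hence
   spanned by y for a suitable u.  So y is a smooth lift of phi_-, and phi_+ is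
   the phi_- of the opposite algebra.  A tangent vector of I lies in xi exactly
   when x_i v_(i+1) = 0 and v_i x_(i+1) = 0 for all i, where the sum of the two
   products always vanishes.  For i = 0 and i = 2 this says that V is annihilated
   by phi_- and phi_+.  For i = 1, with z a lift of phi_+, one has
   (a^* (b c)) z = 0 whenever z a = z b = 0; since the second derivatives of x
   are orthogonal to its first derivatives, this gives y z = 0 and (dy) z = 0. *)
Require Import Defs.
From HB Require Import structures.
From mathcomp Require Import all_boot all_order all_algebra.
From mathcomp Require Import all_classical all_reals all_analysis.
From mathcomp Require Import ring lra zify.
Set Implicit Arguments.
Unset Strict Implicit.
Unset Printing Implicit Defensive.
Import Order.TTheory GRing.Theory Num.Theory.
Import numFieldNormedType.Exports.
Local Open Scope classical_set_scope.
Local Open Scope ring_scope.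

(** * Composition algebra *)

HB.instance Definition _ (R : realType) (O : split_octonion R) x :=
  GRing.isLinear.Build R _ _ _ (omul O x) (omul_linear_r O x).

Section Octonions.
Context {R : realType} (O : split_octonion R).
Implicit Types x y z u v w c d : 'rV[R]_8.
Local Notation "x ** y" := (omul O x y) (at level 39, left associativity).
Local Notation N := (onorm O).
Local Notation e := (oone O).

Definition polar x y := N (x + y) - N x - N y.
Local Notation B := polar.

Lemma omulDl x y z : (x + y) ** z = x ** z + y ** z.
Proof. by have := omul_linear_l O z 1 x y; rewrite !scale1r. Qed.

Lemma omul0l z : 0 ** z = 0.
Proof. by apply: (addrI (0 ** z)); rewrite -omulDl !addr0. Qed.

Lemma omulZl a x z : (a *: x) ** z = a *: (x ** z).
Proof. by have := omul_linear_l O z a x 0; rewrite !addr0 omul0l addr0. Qed.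

Lemma omulNl x z : (- x) ** z = - (x ** z).
Proof. by rewrite -scaleN1r omulZl scaleN1r. Qed.

Lemma omulBl x y z : (x - y) ** z = x ** z - y ** z.
Proof. by rewrite omulDl omulNl. Qed.

Lemma onorm_gram : exists2 G : 'M[R]_8, G \in unitmx &
  G^T = G /\ forall x, N x = (x *m G *m x^T) 0 0.
Proof.
have [P Pu NE] := onorm_signature O.
pose s : 'rV[R]_8 := \row_i (if (i < 4)%N then 1 else -1).
exists (P *m diag_mx s *m P^T).
  rewrite !unitmx_mul unitmx_tr Pu andbT /= unitmxE det_diag unitfE.
  by apply/prodf_neq0 => i _; rewrite mxE; case: ifP; rewrite ?oppr_eq0 oner_eq0.
split; first by rewrite !trmx_mul trmxK tr_diag_mx mulmxA.
move=> x; rewrite NE !mulmxA -mulmxA -trmx_mul mul_mx_diag [RHS]mxE.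
rewrite [RHS](bigID (fun i : 'I_8 => (i < 4)%N)) /= -sumrN; congr (_ + _).
  by apply: eq_bigr => i i4; rewrite !mxE i4 mulr1 expr2.
apply: eq_big => [i|i i4]; first by rewrite leqNgt.
by rewrite !mxE ltnNge i4 mulrN1 mulNr expr2.
Qed.

Lemma polar_gram : exists2 G : 'M[R]_8, G \in unitmx &
  forall x y, B x y = (x *m G *m y^T) 0 0.
Proof.
have [G Gu [Gs NG]] := onorm_gram.
exists (2 *: G) => [|x y].
  by rewrite unitmxZ // unitfE pnatr_eq0.
have sym : (y *m G *m x^T) 0 0 = (x *m G *m y^T) 0 0.
  have -> : x *m G *m y^T = (y *m G *m x^T)^T by rewrite !trmx_mul trmxK Gs mulmxA.
  by rewrite [RHS]mxE.
rewrite /polar !NG linearD /= !mulmxDl !mulmxDr -scalemxAr -scalemxAl.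
have addE (A C : 'M[R]_1) : (A + C) 0 0 = A 0 0 + C 0 0 by rewrite mxE.
have scaleE (A : 'M[R]_1) : (2 *: A) 0 0 = 2 * A 0 0 by rewrite mxE.
rewrite !addE scaleE sym; lra.
Qed.

Lemma polarC x y : B x y = B y x.
Proof. by rewrite /polar [x + y]addrC; lra. Qed.

Lemma polarDl x y z : B (x + y) z = B x z + B y z.
Proof. by have [G _ BE] := polar_gram; rewrite !BE !mulmxDl mxE. Qed.

Lemma polarZl a x z : B (a *: x) z = a * B x z.
Proof. by have [G _ BE] := polar_gram; rewrite !BE -!scalemxAl mxE. Qed.

Lemma polarDr x y z : B x (y + z) = B x y + B x z.
Proof. by rewrite polarC polarDl ![B _ x]polarC. Qed.

Lemma polarZr a x z : B x (a *: z) = a * B x z.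
Proof. by rewrite polarC polarZl polarC. Qed.

Lemma polarNl x z : B (- x) z = - B x z.
Proof. by rewrite -scaleN1r polarZl mulN1r. Qed.

Lemma polarNr x z : B x (- z) = - B x z.
Proof. by rewrite polarC polarNl polarC. Qed.

Lemma polar0l z : B 0 z = 0.
Proof. by rewrite -(scale0r 0) polarZl mul0r. Qed.

Lemma polar0r z : B z 0 = 0.
Proof. by rewrite polarC polar0l. Qed.

Lemma onormZ a x : N (a *: x) = a ^+ 2 * N x.
Proof.
have [G _ [_ NG]] := onorm_gram.
by rewrite !NG linearZ /= -scalemxAr -!scalemxAl !mxE mulrA expr2.
Qed.

Lemma onormD x y : N (x + y) = N x + N y + B x y.
Proof. by rewrite /polar; lra. Qed.

Lemma polar_self x : B x x = 2 * N x.
Proof. by rewrite /polar -mulr2n -scaler_nat onormZ; lra. Qed.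

Lemma polar_inj x y : (forall z, B x z = B y z) -> x = y.
Proof.
have [G Gu BE] := polar_gram => xy.
suff /(congr1 (mulmx^~ (invmx G))) : x *m G = y *m G by rewrite !mulmxK.
apply/rowP => i; have := xy (delta_mx 0 i).
by rewrite !BE !trmx_delta -!colE ![col _ _ _ _]mxE.
Qed.

(** Nondegeneracy turns a right inverse of [M] into dual vectors: its transpose is multiplied by the
    inverse Gram matrix. *)
Lemma polar_dual n (M : 'M[R]_(n, 8)) : row_free M ->
  exists W : 'M[R]_(n, 8), forall i j, B (row i W) (row j M) = (i == j)%:R.
Proof.
have [G Gu BE] := polar_gram => /row_freeP[C MC].
exists (C^T *m invmx G) => i j; rewrite BE -row_mul mulmxKV // tr_row.
have : (C^T *m M^T) i j = (i == j)%:R by rewrite -trmx_mul MC trmx1 mxE.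
by rewrite !mxE => <-; apply: eq_bigr => k _; rewrite !mxE.
Qed.

(** If the unit had norm zero, multiplicativity would make the norm and its polar form vanish,
    against nondegeneracy. *)
Lemma onorm_one : N e = 1.
Proof.
have [N0|N0] := eqVneq (N e) 0; last first.
  by apply: (mulfI N0); rewrite -onormM omul1l mulr1.
have NE x : N x = 0 by rewrite -(omul1l O x) onormM N0 mul0r.
have e0 x : x = 0 by apply: polar_inj => z; rewrite /polar !NE.
have := congr1 (fun v : 'rV[R]_8 => v 0 0) (e0 (const_mx 1)).
by rewrite !mxE => /eqP; rewrite oner_eq0.
Qed.

Lemma polar_mull x y z : B (x ** y) (x ** z) = N x * B y z.
Proof. by rewrite /polar -linearD !onormM; ring. Qed.

(** Linearises [polar_mull] in the left factor; the adjunctions and Clifford relations below rest on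
    it. *)
Lemma polar_mul4 x w y z : B (x ** y) (w ** z) + B (x ** z) (w ** y) = B x w * B y z.
Proof.
have := polar_mull (x + w) y z.
rewrite !omulDl !polarDl !polarDr !polar_mull onormD (polarC (w ** y)); lra.
Qed.

(** * Conjugation, adjunction and the Clifford relations *)

Definition oconj x := B x e *: e - x.
Local Notation "x ^*" := (oconj x) : ring_scope.

Lemma oconjD x y : (x + y)^* = x^* + y^*.
Proof. by rewrite /oconj polarDl scalerDl opprD addrACA. Qed.

Lemma oconjZ a x : (a *: x)^* = a *: x^*.
Proof. by rewrite /oconj polarZl scalerBr scalerA. Qed.

Lemma oconj0 : 0^* = 0.
Proof. by rewrite -(scale0r 0) oconjZ !scale0r. Qed.

Lemma polar_conj_one x : B x^* e = B x e.
Proof. by rewrite /oconj polarDl polarZl polarNl polar_self onorm_one; lra. Qed.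

Lemma oconjK : involutive oconj.
Proof. by move=> x; rewrite {1}/oconj polar_conj_one /oconj opprB addrC subrK. Qed.

Lemma polar_conj x y : B x^* y^* = B x y.
Proof.
rewrite /oconj !(polarDl, polarDr, polarZl, polarZr, polarNl, polarNr).
by rewrite polar_self onorm_one (polarC e y); lra.
Qed.

Lemma polar_conjl x y : B x^* y = B x y^*.
Proof. by rewrite -polar_conj oconjK. Qed.

Lemma onorm_conj x : N x^* = N x.
Proof. by have := polar_conj x x; rewrite !polar_self; lra. Qed.

Lemma polar_adjl x y z : B (x ** y) z = B y (x^* ** z).
Proof.
have := polar_mul4 x e y z; rewrite !omul1l /oconj omulBl omulZl omul1l.
by rewrite polarDr polarNr polarZr (polarC (x ** z)); lra.
Qed.

Lemma polar_adjr x y z : B (y ** x) z = B y (z ** x^*).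
Proof.
have := polar_mul4 y z x e; rewrite !omul1r /oconj linearB linearZ /= omul1r.
by rewrite polarDr polarNr polarZr; lra.
Qed.

(** The form is nondegenerate, so it suffices to pair with every [z] and move [oconj x] across by
    adjunction. This takes the place of associativity. *)
Lemma conj_mulK x y : x^* ** (x ** y) = N x *: y.
Proof. by apply: polar_inj => z; rewrite polar_adjl oconjK polar_mull polarZl. Qed.

Lemma mul_conjK x y : x ** (x^* ** y) = N x *: y.
Proof. by have := conj_mulK x^* y; rewrite oconjK onorm_conj. Qed.

(** The Clifford relation, a polarised [conj_mulK]: for orthogonal [x] and [w] the two orders differ
    by a sign. *)
Lemma conj_mul_swap x w y : x^* ** (w ** y) + w^* ** (x ** y) = B x w *: y.
Proof.
apply: polar_inj => z.
rewrite polarDl (polar_adjl x^*) (polar_adjl w^*) !oconjK polarZl.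
by rewrite -polar_mul4 addrC (polarC (w ** y)).
Qed.

Lemma mul_conj_swap x w y : x ** (w^* ** y) + w ** (x^* ** y) = B x w *: y.
Proof. by have := conj_mul_swap x^* w^* y; rewrite !oconjK polar_conj. Qed.

Lemma oconjM x y : (x ** y)^* = y^* ** x^*.
Proof.
apply: polar_inj => z; rewrite polar_conjl polar_adjl.
by rewrite [in RHS]polar_adjl oconjK [RHS]polarC polar_adjr.
Qed.

(** Pairing with [c] moves the factors onto [(oconj x ** c) ** z], which the conjugated Clifford
    relation and [z ** x = 0] make a multiple of [oconj x]. *)
Lemma mul_mul_conj_ker z x d : z ** x = 0 -> x ** (d ** z^*) = B (x ** d) e *: z^*.
Proof.
move=> zx; apply: polar_inj => c.
have -> : B (x ** (d ** z^*)) c = B d ((x^* ** c) ** z).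
  by rewrite polar_adjl polar_adjr oconjK.
have -> : (x^* ** c) ** z = B z c^* *: x^*.
  by rewrite -oconjZ -conj_mul_swap zx linear0 addr0 !oconjM !oconjK.
by rewrite polarZr polarZl polar_adjl omul1r -polar_conjl mulrC (polarC z^*).
Qed.

(** By adjunction, the pairing with [d] is a multiple of the pairing of [c] with
    [oconj x1 ** oconj z], the conjugate of [z ** x1]. *)
Lemma spinor_mul_ker z x x1 c : z ** x = 0 -> z ** x1 = 0 ->
  (x^* ** (x1 ** c)) ** z = 0.
Proof.
move=> zx zx1; apply: polar_inj => d.
rewrite polar_adjr polar_adjl oconjK mul_mul_conj_ker // polarZr polar0l.
by rewrite (polar_adjl x1) -oconjM zx1 oconj0 polar0r mulr0.
Qed.

(** * Common annihilators and their ranks *)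

Definition lmx x : 'M[R]_8 := lin1_mx (omul O x).

Lemma mul_lmx x y : y *m lmx x = x ** y.
Proof. exact: mul_rV_lin1. Qed.

(** The annihilator is stored as a row space, so that rank-nullity for matrices applies to it. *)
Definition annmx (s : seq 'rV[R]_8) : 'M[R]_8 :=
  foldr (fun x K => (K :&: kermx (lmx x))%MS) 1%:M s.

Lemma annmxP s y : reflect {in s, forall x, x ** y = 0} (y <= annmx s)%MS.
Proof.
elim: s => [|x s IHs] /=; first by rewrite submx1; constructor.
rewrite sub_capmx; apply: (iffP andP) => [[/IHs sy /sub_kermxP xy] v|vy].
  by rewrite inE => /predU1P[->|/sy//]; rewrite -mul_lmx.
split; first by apply/IHs => v vs; rewrite vy // inE vs orbT.
by apply/sub_kermxP; rewrite mul_lmx vy // mem_head.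
Qed.

(** Orthogonality of [x] to [s] gives one inclusion by anticommutation. For the other, the Clifford
    relation of [x] and [w] shows that [oconj w ** y] is a preimage of [y]. *)
Lemma annmx_cons x s w : N x = 0 -> {in s, forall v, B x v = 0} ->
    B x w = 1 -> {in s, forall v, B w v = 0} ->
  (annmx s *m lmx x :=: annmx (map oconj (x :: s)))%MS.
Proof.
move=> Nx xs xw ws; apply/eqmxP/andP; split; apply/row_subP => i.
  have /annmxP sy := row_sub i (annmx s).
  rewrite row_mul mul_lmx; apply/annmxP => _ /mapP[v + ->].
  rewrite inE => /predU1P[->|vs]; first by rewrite conj_mulK Nx scale0r.
  have := conj_mul_swap v x (row i (annmx s)).
  by rewrite (sy _ vs) linear0 addr0 polarC xs // scale0r.
have /annmxP sy := row_sub i (annmx (map oconj (x :: s))).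
set y := row i _ in sy *.
have := mul_conj_swap x w y; rewrite xw scale1r (sy x^*) ?mem_head //.
rewrite linear0 addr0 => <-; rewrite -mul_lmx submxMr //.
apply/annmxP => v vs; have := mul_conj_swap v w y.
rewrite (sy v^*) ?linear0 ?addr0 //; last by rewrite inE map_f ?orbT.
by rewrite polarC ws // scale0r.
Qed.

(** Rank-nullity for multiplication by [x] on the annihilator of [s]; its kernel there is the
    annihilator of [x :: s]. *)
Lemma rank_annmx_cons x s w : N x = 0 -> {in s, forall v, B x v = 0} ->
    B x w = 1 -> {in s, forall v, B w v = 0} ->
  (\rank (annmx (map oconj (x :: s))) + \rank (annmx (x :: s)))%N = \rank (annmx s).
Proof.
move=> Nx xs xw ws; rewrite -(annmx_cons Nx xs xw ws).
exact: mxrank_mul_ker.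
Qed.

Lemma eq_annmx s t : s =i t -> (annmx s :=: annmx t)%MS.
Proof.
move=> st; apply/eqmxP/andP; split; apply/row_subP => i; apply/annmxP => x xs;
  by apply: (annmxP _ _ (row_sub i _)); rewrite ?st // -st.
Qed.

Lemma map_oconjK s : map oconj (map oconj s) = s.
Proof. exact: (mapK oconjK). Qed.

(** * The spinor of an isotropic triple *)

Definition isotropic3 x0 x1 x2 :=
  [/\ N x0 = 0, N x1 = 0, N x2 = 0, B x0 x1 = 0 & B x0 x2 = 0 /\ B x1 x2 = 0].

Definition free3 x0 x1 x2 :=
  forall a b c : R, a *: x0 + b *: x1 + c *: x2 = 0 -> [/\ a = 0, b = 0 & c = 0].

(** Three Clifford operators applied to a half-spinor [u]; conjugated and plain factors alternate
    because each operator exchanges the two half-spin copies of the algebra. *)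
Definition spinor x0 x1 x2 u := x0^* ** (x1 ** (x2^* ** u)).

(** Anticommutation brings each vector next to its own conjugate, where the product is
    multiplication by a zero norm. *)
Lemma spinor_ker x0 x1 x2 u : isotropic3 x0 x1 x2 ->
  let y := spinor x0 x1 x2 u in [/\ x0 ** y = 0, x1 ** y = 0 & x2 ** y = 0].
Proof.
case=> N0 N1 N2 B01 [B02 B12] /=; rewrite /spinor.
have swap x w y : B x w = 0 -> x ** (w^* ** y) = - (w ** (x^* ** y)).
  by move=> xw; apply/eqP; rewrite -addr_eq0 mul_conj_swap xw scale0r.
have swap' x w y : B x w = 0 -> x^* ** (w ** y) = - (w^* ** (x ** y)).
  by move=> xw; apply/eqP; rewrite -addr_eq0 conj_mul_swap xw scale0r.
split; first by rewrite mul_conjK N0 scale0r.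
  by rewrite swap 1?polarC // conj_mulK N1 scale0r linear0 oppr0.
rewrite swap 1?polarC // swap' 1?polarC // mul_conjK N2.
by rewrite scale0r linear0 oppr0 linear0 oppr0.
Qed.

Definition dual3 x0 x1 x2 w0 w1 w2 :=
  [/\ [/\ B x0 w0 = 1, B x1 w0 = 0 & B x2 w0 = 0],
      [/\ B x0 w1 = 0, B x1 w1 = 1 & B x2 w1 = 0] &
      [/\ B x0 w2 = 0, B x1 w2 = 0 & B x2 w2 = 1]].

Lemma exists_dual3 x0 x1 x2 : free3 x0 x1 x2 ->
  exists w : 'rV[R]_8 * 'rV[R]_8 * 'rV[R]_8, dual3 x0 x1 x2 w.1.1 w.1.2 w.2.
Proof.
move=> fx; pose x := [:: x0; x1; x2].
pose M : 'M[R]_(3, 8) := \matrix_(i < 3) x`_i.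
have rM i : row i M = x`_i by apply: rowK.
have /polar_dual[W BW] : row_free M.
  apply: inj_row_free => v; rewrite mulmx_sum_row !big_ord_recl big_ord0 !rM.
  rewrite /= addr0 addrA => /fx[v0 v1 v2]; apply/rowP => i; rewrite mxE.
  by case: i => [[|[|[|]]]] // i3; [rewrite -[RHS]v0|rewrite -[RHS]v1|rewrite -[RHS]v2];
    congr (v 0 _); apply: val_inj.
exists (row 0 W, row 1 W, row 2%R W).
have BWE (i j : 'I_3) : B x`_j (row i W) = (i == j)%:R by rewrite -rM polarC BW.
split; split; [exact: (BWE 0 0) | exact: (BWE 0 1) | exact: (BWE 0 2%R)
  |exact: (BWE 1 0) | exact: (BWE 1 1) | exact: (BWE 1 2%R)
  |exact: (BWE 2%R 0) | exact: (BWE 2%R 1) | exact: (BWE 2%R 2%R)].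
Qed.

(** Three applications of [annmx_cons], starting from the whole algebra. Row vectors act from the
    left, so this product of matrices sends [u] to [spinor x0 x1 x2 u]. *)
Lemma annmx3E x0 x1 x2 w0 w1 w2 :
    isotropic3 x0 x1 x2 -> dual3 x0 x1 x2 w0 w1 w2 ->
  (annmx [:: x0; x1; x2] :=: lmx x2^* *m lmx x1 *m lmx x0^*)%MS.
Proof.
case=> N0 N1 N2 B01 [B02 B12] [[w00 w01 w02] [w10 w11 w12] [w20 w21 w22]].
have N' := onorm_conj; have B' := polar_conj.
(* Double conjugates give the list the shape [map oconj (x :: s)] that [annmx_cons] produces. *)
rewrite -[x0]oconjK -[x2]oconjK -[x1]oconjK.
apply: eqmx_trans (eqmx_sym (@annmx_cons x0^* [:: x1^*; x2^*] w0^* _ _ _ _)) _;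
  rewrite ?N' ?B' //.
- by move=> v; rewrite !inE => /orP[]/eqP->; rewrite B' // polarC.
- by move=> v; rewrite !inE => /orP[]/eqP->; rewrite B' // polarC.
rewrite !oconjK; apply: eqmxMr.
apply: eqmx_trans (eqmx_sym (@annmx_cons x1 [:: x2] w1 _ _ _ _)) _ => //.
- by move=> v; rewrite !inE => /eqP-> //; rewrite polarC.
- by move=> v; rewrite !inE => /eqP-> //; rewrite polarC.
apply: eqmxMr; rewrite -[in X in (X :=: _)%MS](oconjK x2).
apply: eqmx_trans (eqmx_sym (@annmx_cons x2^* [::] w2^* _ _ _ _)) _;
  rewrite ?N' ?B' //.
by rewrite mul1mx.
Qed.

(** Each vector halves the rank, 8, 4, 2, 1: in [rank_annmx_cons] the two summands are equal,
    because conjugating the list does not change the rank of its annihilator. *)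
Lemma rank_annmx3 x0 x1 x2 w0 w1 w2 :
    isotropic3 x0 x1 x2 -> dual3 x0 x1 x2 w0 w1 w2 ->
  \rank (annmx [:: x0; x1; x2]) = 1%N.
Proof.
move=> iso dual; have E3 := annmx3E iso dual.
have iso' : isotropic3 x0^* x1^* x2^*.
  by case: iso; rewrite /isotropic3 !onorm_conj !polar_conj.
have rev a0 a1 a2 : isotropic3 a0 a1 a2 -> isotropic3 a2 a1 a0.
  by case=> ? ? ? ? [? ?]; do ?split; rewrite // polarC.
have dual' : dual3 x2^* x1^* x0^* w2^* w1^* w0^*.
  by case: dual => [[? ? ?] [? ? ?] [? ? ?]]; do ?split; rewrite polar_conj.
have E3' := annmx3E (rev _ _ _ iso') dual'.
have [G Gu BE] := polar_gram.
(* Matrix form of [polar_adjl]. *)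
have lmxG x : lmx x *m G = G *m (lmx x^*)^T.
  apply/matrixP => i j; have := polar_adjl x (delta_mx 0 i) (delta_mx 0 j).
  have ent (A : 'M[R]_8) :
      ((delta_mx 0 i : 'rV_8) *m A *m (delta_mx 0 j : 'rV_8)^T) 0 0 = A i j.
    by rewrite -(rowE i A) trmx_delta -colE !mxE.
  rewrite !BE -!mul_lmx trmx_mul !mulmxA -(mulmxA _ (lmx x) G).
  by rewrite -(mulmxA _ G (lmx x^*)^T) !ent.
(* The two products of annmx3E are adjoint for the norm form. *)
have r33' : \rank (annmx [:: x0; x1; x2]) = \rank (annmx (map oconj [:: x0; x1; x2])).
  have /eq_annmx-> : map oconj [:: x0; x1; x2] =i [:: x2^*; x1^*; x0^*].
    by move=> v; rewrite !inE orbA orbC [(_ == _) || (_ == _)]orbC.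
  rewrite E3 E3' -(mxrankMfree _ (_ : row_free G)) ?row_free_unit //.
  rewrite -!mulmxA lmxG !(mulmxA _ G) lmxG -!mulmxA !(mulmxA _ G) lmxG -!mulmxA !oconjK.
  by rewrite -!trmx_mul eqmxMfull ?mxrank_tr ?mulmxA // row_full_unit.
case: iso => N0 N1 N2 B01 [B02 B12].
case: dual => [[w00 w01 w02] [w10 w11 w12] [w20 w21 w22]].
(* Conjugating [a], [s] and [w] only exchanges the summands of [rank_annmx_cons], so [s] and its
   conjugate have annihilators of the same rank. The full triple is not of this kind and was settled
   by [r33']. *)
have step a s w : N a = 0 -> {in s, forall v, B a v = 0} ->
    B a w = 1 -> {in s, forall v, B w v = 0} ->
    (\rank (annmx s) = \rank (annmx (map oconj (a :: s))) + \rank (annmx (a :: s)))%N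
    /\ \rank (annmx (map oconj s)) = \rank (annmx s).
  move=> Na as0 aw ws; rewrite (rank_annmx_cons Na as0 aw ws); split=> //.
  rewrite -(@rank_annmx_cons a^* (map oconj s) w^*) ?onorm_conj ?polar_conj //.
  - by rewrite -map_cons map_oconjK addnC (rank_annmx_cons Na as0 aw ws).
  - by move=> _ /mapP[v vs ->]; rewrite polar_conj as0.
  - by move=> _ /mapP[v vs ->]; rewrite polar_conj ws.
have [] := step x2 [::] w2 N2 _ w22 _ => // r2 _.
have [] := step x1 [:: x2] w1 N1 _ w11 _.
- by move=> v; rewrite !inE => /eqP->.
- by move=> v; rewrite !inE => /eqP->; rewrite polarC.
move=> r1 r2'.
have [] := step x0 [:: x1; x2] w0 N0 _ w00 _.
- by move=> v; rewrite !inE => /orP[]/eqP->.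
- by move=> v; rewrite !inE => /orP[]/eqP->; rewrite polarC.
rewrite -r33' => r0 r1'; move: r2 r1.
have r8 : \rank (annmx [::]) = 8%N by rewrite mxrank1.
rewrite r2' r1' r0 r8; move: (\rank _) (\rank _) => a b; lia.
Qed.

Lemma spinor_unique x0 x1 x2 : isotropic3 x0 x1 x2 -> free3 x0 x1 x2 ->
  exists2 u, spinor x0 x1 x2 u != 0 &
    forall y, x0 ** y = 0 -> x1 ** y = 0 -> x2 ** y = 0 ->
    exists k, y = k *: spinor x0 x1 x2 u.
Proof.
move=> iso /exists_dual3[w dual]; have rk := rank_annmx3 iso dual.
have E3 := annmx3E iso dual.
set T := (_ *m _ *m _) in E3; have rkT : \rank T = 1%N by rewrite -E3.
(* [T] has rank one, so a nonzero row spans its row space; row [i] is the spinor whose seed is the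
   [i]-th basis vector. *)
have [i Ti] : exists i, row i T != 0.
  apply/existsP; rewrite -negb_forall; apply/negP => /forallP T0.
  move: rkT; suff -> : T = 0 by rewrite mxrank0.
  by apply/row_matrixP => i; rewrite row0; apply/eqP.
have Tiu : row i T = spinor x0 x1 x2 (delta_mx 0 i).
  by rewrite rowE /T !mulmxA !mul_lmx.
exists (delta_mx 0 i); rewrite -Tiu // => y y0 y1 y2.
have : (y <= annmx [:: x0; x1; x2])%MS.
  by apply/annmxP => v; rewrite !inE => /or3P[]/eqP->.
rewrite E3 => yT; apply/sub_rVP; apply: (submx_trans yT).
have := mxrank_leqif_sup (row_sub i T).
by rewrite rkT rank_rV Ti => -[_ <-].
Qed.

Lemma onorm_mul0l x y : x ** y = 0 -> y != 0 -> N x = 0.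
Proof.
move=> xy0 y0; have := conj_mulK x y; rewrite xy0 linear0 => /esym/eqP.
by rewrite scaler_eq0 (negPf y0) orbF => /eqP.
Qed.

Lemma onorm_mul0r x y : x ** y = 0 -> x != 0 -> N y = 0.
Proof.
move=> xy0 x0; rewrite -onorm_conj; apply: (@onorm_mul0l _ x^*).
  by rewrite -oconjM xy0 oconj0.
by apply: contraNneq x0 => /(congr1 oconj); rewrite oconjK oconj0 => ->.
Qed.

(** Exchanging [x1] and [x2] up to sign lets [spinor_mul_ker] apply to [x0] and [x2]. It serves when
    [x1] is a second derivative, about whose product with [z] nothing is known. *)
Lemma spinor_mul_swap x0 x1 x2 c z : B x1 x2 = 0 ->
    z ** x0 = 0 -> z ** x2 = 0 -> spinor x0 x1 x2 c ** z = 0.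
Proof.
move=> x12 zx0 zx2; have := mul_conj_swap x1 x2 c; rewrite x12 scale0r => /eqP.
rewrite addr_eq0 /spinor => /eqP->.
by rewrite linearN omulNl spinor_mul_ker ?oppr0.
Qed.

End Octonions.

(* Turns phi_plus into phi_minus. *)
Definition opp_octonion (R : realType) (O : split_octonion R) : split_octonion R :=
  @SplitOctonion R (fun x y => omul O y x) (oone O) (onorm O)
    (omul_linear_r O) (omul_linear_l O) (omul1r O) (omul1l O) (onorm_signature O)
    (fun x y => etrans (onormM O y x) (mulrC _ _)).

(** * Differential calculus *)

Section Differentiability.
Context {R : realType}.
Implicit Types V W : normedModType R.

Lemma near_eq_diff V W (f g : V -> W) (x : V) :
  (\near x, f x = g x) -> differentiable f x ->
  differentiable g x /\ 'd g x = 'd f x :> (V -> W).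
Proof.
move=> fg df; have [dc dE] := (diff_locallyP _ _).1 df.
have fgx : f x = g x := nbhs_singleton fg.
have gE : g \o shift x = cst (g x) + 'd f x +o_ 0 id.
  apply/eqaddoP => eps eps0.
  have /eqaddoP/(_ eps eps0) := dE.
  have : \forall y \near 0, f (y + x) = g (y + x).
    by move: fg; rewrite (near_shift 0) subr0.
  apply: filterS2 => y /= fgy.
  by rewrite -fgx !fctE /= fgy.
have gd := diff_unique dc gE.
split; last exact: gd.
have [h gh hE] : exists2 h : V -> W, 'd g x = h :> (V -> W) &
    continuous h /\ g \o shift x = cst (g x) + h +o_ 0 id.
  by exists ('d f x) => //; split.
by apply/diff_locallyP; rewrite gh.
Qed.

(** In coordinates the map is a finite sum of products of continuous functions. *)
Lemma rV_bilinear_continuous m n W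
    (b : {bilinear 'rV[R]_m.+1 -> 'rV[R]_n.+1 -> W}) :
  continuous (fun p => b p.1 p.2).
Proof.
move=> p; have -> : (fun p => b p.1 p.2) = fun p =>
    \sum_i \sum_j (p.1 0 i * p.2 0 j) *: b (delta_mx 0 i) (delta_mx 0 j).
  apply/funext => q; rewrite {1}[q.1]row_sum_delta linear_sumlz.
  apply: eq_bigr => i _; rewrite {1}[q.2]row_sum_delta linear_sumr.
  by apply: eq_bigr => j _; rewrite linearZl_LR linearZr_LR scalerA.
apply: (@continuous_big _ _ _ _ xpredT) => [q|i _].
  exact: add_continuous.
apply: (@continuous_big _ _ _ _ xpredT) => [q|j _].
  exact: add_continuous.
move=> q; apply: cvgZr_tmp; apply: cvgM.
  apply: (@continuous_comp _ _ _ fst (fun M : 'rV[R]_m.+1 => M 0 i)).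
    exact: cvg_fst.
  exact: coord_continuous.
apply: (@continuous_comp _ _ _ snd (fun M : 'rV[R]_n.+1 => M 0 j)).
  exact: cvg_snd.
exact: coord_continuous.
Qed.

Lemma mk_bilinear m n (W : lmodType R) (b : 'rV[R]_m -> 'rV[R]_n -> W) :
  (forall y, linear (b^~ y)) -> (forall x, linear (b x)) ->
  exists b' : {bilinear 'rV[R]_m -> 'rV[R]_n -> W}, b = b' :> ('rV[R]_m -> 'rV[R]_n -> W).
Proof.
move=> bl br.
have H : bilinear_for (GRing.Scale.Law.clone _ _ *:%R _)
    (GRing.Scale.Law.clone _ _ *:%R _) b.
  by split=> ?; [apply: bl | apply: br].
pose bM := bilinear_isBilinear.Build R 'rV[R]_m 'rV[R]_n W _ _ b H.
pose b' : {bilinear _ -> _ -> _} := HB.pack b bM.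
by exists b'.
Qed.

Lemma diff_bilinear_comp m n V W
    (b : 'rV[R]_m.+1 -> 'rV[R]_n.+1 -> W)
    (f : V -> 'rV[R]_m.+1) (g : V -> 'rV[R]_n.+1) x :
  (forall y, linear (b^~ y)) -> (forall y, linear (b y)) ->
  differentiable f x -> differentiable g x ->
  differentiable (fun t => b (f t) (g t)) x /\
  forall v, 'd (fun t => b (f t) (g t)) x v =
    b ('d f x v) (g x) + b (f x) ('d g x v).
Proof.
move=> bl br df dg; have [{bl br}b' -> {b}] := mk_bilinear bl br.
have bc := @rV_bilinear_continuous _ _ _ b'.
have -> : (fun t => b' (f t) (g t)) =
    (fun p => b' p.1 p.2) \o (fun t => (f t, g t)) by [].
have dfg := differentiable_pair df dg.
have db := @differentiable_bilin _ _ _ _ b' (f x, g x) bc.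
split; first exact: differentiable_comp.
move=> v; rewrite diff_comp // diff_bilin // /= diff_pair //=.
by rewrite addrC.
Qed.

Lemma is_derive_line V W (f : V -> W) (x u : V) (s : R) df :
  is_derive (x + s *: u) u f df -> is_derive s 1 (fun s => f (x + s *: u)) df.
Proof.
have E : (fun h => h^-1 *:
     (((fun s => f (x + s *: u)) \o shift s) (h *: 1) - f (x + s *: u))) =
   (fun h => h^-1 *: ((f \o shift (x + s *: u)) (h *: u) - f (x + s *: u))).
  apply/funext => h /=; congr (_ *: (f _ - _)).
  by rewrite [h%:A]mulr1 scalerDl addrCA.
move=> [dv <-]; split; first by move: dv; rewrite /derivable -E.
by rewrite /derive -E.
Qed.

(** * Symmetry of mixed derivatives *)

Lemma MVT_cc (f df : R -> R) (h : R) : 0 < h ->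
  (forall s, 0 <= s <= h -> is_derive s 1 f (df s)) ->
  exists2 c, 0 <= c <= h & f h - f 0 = h * df c.
Proof.
move=> h0 fd; have [s sh||c ch E] := @MVT R f df 0 h h0.
- by apply: fd; move: sh; rewrite in_itv /= => /andP[/ltW-> /ltW->].
- by apply: derivable_within_continuous => s; rewrite in_itv /= => /fd [].
exists c; last by rewrite E subr0 mulrC.
by move: ch; rewrite in_itv /= => /andP[/ltW-> /ltW->].
Qed.

(** The mean value theorem is used twice: along [u] for the increment of [f] in the direction [v],
    then along [v] for [fu]. *)
Lemma second_difference V (f fu fuv : V -> R) (x u v : V) (h : R) : 0 < h ->
  (forall s t, 0 <= s <= h -> 0 <= t <= h ->
     is_derive (x + s *: u + t *: v) u f (fu (x + s *: u + t *: v)) /\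
     is_derive (x + s *: u + t *: v) v fu (fuv (x + s *: u + t *: v))) ->
  exists s t, [/\ 0 <= s <= h, 0 <= t <= h &
    f (x + h *: u + h *: v) - f (x + h *: u) - (f (x + h *: v) - f x) =
    h * (h * fuv (x + s *: u + t *: v))].
Proof.
move=> h0 fd.
pose g s := f ((x + h *: v) + s *: u) - f (x + s *: u).
have hh : 0 <= h <= h by rewrite ltW /=.
have h00 : 0 <= (0 : R) <= h by rewrite lexx ltW.
have [s sh|s sh gs] := @MVT_cc g
    (fun s => fu ((x + h *: v) + s *: u) - fu (x + s *: u)) h h0.
  apply: is_deriveB; apply: is_derive_line.
    by rewrite addrAC; have [] := fd _ _ sh hh.
  by have [] := fd _ _ sh h00; rewrite scale0r addr0.
have [t th|t th ft] := @MVT_cc (fun t => fu (x + s *: u + t *: v))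
    (fun t => fuv (x + s *: u + t *: v)) h h0.
  by apply: is_derive_line; have [] := fd _ _ sh th.
exists s, t; split=> //; rewrite -ft scale0r addr0 (addrAC x (s *: u)) -gs /g.
by rewrite !scale0r !addr0 (addrAC x (h *: u)).
Qed.

(** The second difference is symmetric in [u] and [v], so values of [fuv] and [fvu] at two points
    near [x] agree; continuity brings both points to [x]. *)
Lemma mixed_derivatives V (f fu fv fuv fvu : V -> R) (x u v : V) :
  (\forall y \near x, [/\ is_derive y u f (fu y), is_derive y v f (fv y),
     is_derive y v fu (fuv y) & is_derive y u fv (fvu y)]) ->
  {for x, continuous fuv} -> {for x, continuous fvu} -> fuv x = fvu x.
Proof.
move=> fd cuv cvu; apply/eqP; rewrite -subr_eq0 -normr_le0; apply/ler_addgt0Pr => e e0.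
rewrite add0r.
have e2 : 0 < e / 2 by rewrite divr_gt0.
have : \forall y \near x, [/\ [/\ is_derive y u f (fu y), is_derive y v f (fv y),
     is_derive y v fu (fuv y) & is_derive y u fv (fvu y)],
     `|fuv x - fuv y| < e / 2 & `|fvu x - fvu y| < e / 2].
  near=> y; split; near: y => //.
  - by move/cvgrPdist_lt : cuv; apply.
  - by move/cvgrPdist_lt : cvu; apply.
move=> /nbhs_ballP[d /= d0 dP].
(* With [h = d / (2 M)] the parallelogram of sides [h u] and [h v] stays in the ball of radius [d];
   the added 1 keeps [M] positive. *)
pose M := `|u| + `|v| + 1.
have M0 : 0 < M by rewrite ltr_pwDr // addr_ge0.
pose h := d / (2 * M).
have h0 : 0 < h by rewrite divr_gt0 // mulr_gt0.
have inb s t : 0 <= s <= h -> 0 <= t <= h -> ball x d (x + s *: u + t *: v).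
  move=> /andP[s0 sh] /andP[t0 th]; rewrite -ball_normE /= -addrA opprD addNKr normrN.
  apply: le_lt_trans (ler_normD _ _) _; rewrite !normrZ !ger0_norm //.
  have su : s * `|u| <= h * `|u| by rewrite ler_wpM2r.
  have tv : t * `|v| <= h * `|v| by rewrite ler_wpM2r.
  apply: le_lt_trans (lerD su tv) _; rewrite -mulrDr /h -mulrA gtr_pMr //.
  rewrite ltr_pdivrMl ?mulr_gt0 // mulr1 /M.
  by have := normr_ge0 u; have := normr_ge0 v; lra.
have [s t sh th|s [t [sh th E]]] := @second_difference V f fu fuv x u v h h0.
  by have [[]] := dP _ (inb _ _ sh th).
have [s' t' sh' th'|s' [t' [sh' th' E']]] := @second_difference V f fv fvu x v u h h0.
  by rewrite addrAC; have [[]] := dP _ (inb _ _ th' sh').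
have : fuv (x + s *: u + t *: v) = fvu (x + s' *: v + t' *: u).
  have hn0 : h != 0 by rewrite gt_eqF.
  apply: (mulfI hn0); apply: (mulfI hn0); rewrite -E -E' (addrAC x (h *: v)); ring.
have [_ b1 _] := dP _ (inb _ _ sh th).
have [_ _ b2] := dP _ (inb _ _ th' sh'); rewrite addrAC in b2.
move=> E''; rewrite E'' in b1; rewrite distrC in b2.
have -> : fuv x - fvu x = (fuv x - fvu (x + s' *: v + t' *: u))
   + (fvu (x + s' *: v + t' *: u) - fvu x) by ring.
by apply: le_trans (ler_normD _ _) _; lra.
Unshelve. all: by end_near. Qed.

End Differentiability.

(** * Maps of class C^k *)

Section Smoothness.
Context {R : realType}.
Implicit Types V W : normedModType R.

Lemma Ck_on_eq V W k (U : set V) (f g : V -> W) : open U ->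
  (forall x, U x -> f x = g x) -> Ck_on k U f -> Ck_on k U g.
Proof.
move=> oU; elim: k f g => [|k IHk] f g fg /=.
  move=> fc x Ux; have near_fg : \forall y \near x, f y = g y.
    by apply: filterS (open_nbhs_nbhs (conj oU Ux)) => y /fg.
  have gc : g @ x --> f x by apply: cvg_trans (fc x Ux); apply: near_eq_cvg.
  by rewrite fg in gc.
move=> [df Df]; split=> [x Ux|v].
  have near_fg : \forall y \near x, f y = g y.
    by apply: filterS (open_nbhs_nbhs (conj oU Ux)) => y /fg.
  by have [] := near_eq_diff near_fg (df x Ux).
apply: IHk (Df v) => x Ux; apply: near_eq_derive.
by apply: filterS (open_nbhs_nbhs (conj oU Ux)) => y /fg.
Qed.

Lemma Ck_onW V W k (U : set V) (f : V -> W) : Ck_on k.+1 U f -> Ck_on k U f.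
Proof.
elim: k f => [|k IHk] f [df Df].
  by move=> x /df /differentiable_continuous.
by split=> // v; apply: IHk.
Qed.

Lemma Ck_on_sub V W k (U U' : set V) (f : V -> W) : U' `<=` U ->
  Ck_on k U f -> Ck_on k U' f.
Proof.
move=> UU'; elim: k f => [|k IHk] f; first by move=> fc x /UU' /fc.
by move=> [df Df]; split=> [x /UU'|v]; [exact: df|exact: IHk (Df v)].
Qed.

Lemma Ck_on_cst V W k (U : set V) (c : W) : Ck_on k U (fun=> c).
Proof.
elim: k c => [|k IHk] c /=; first by move=> x _; apply: cvg_cst.
split=> [x _|v]; first exact: differentiable_cst.
suff -> : (fun x => 'D_v (fun=> c) x) = (fun=> 0 : W) by apply: IHk.
by apply/funext => x; apply: derive_cst.
Qed.

Lemma Ck_onD V W k (U : set V) (f g : V -> W) : open U ->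
  Ck_on k U f -> Ck_on k U g -> Ck_on k U (fun x => f x + g x).
Proof.
move=> oU; elim: k f g => [|k IHk] f g.
  by move=> fc gc x Ux; apply: cvgD; [apply: fc|apply: gc].
move=> [df Df] [dg Dg]; split=> [x Ux|v].
  by apply: differentiableD; [apply: df|apply: dg].
apply: (Ck_on_eq oU _ (IHk _ _ (Df v) (Dg v))) => x Ux.
by rewrite deriveD //; apply: diff_derivable; [apply: df|apply: dg].
Qed.

Lemma Ck_on_sum V W k (U : set V) (I : Type) (r : seq I) (f : I -> V -> W) : open U ->
  (forall i, Ck_on k U (f i)) -> Ck_on k U (fun x => \sum_(i <- r) f i x).
Proof.
move=> oU fk; elim: r => [|i r IHr].
  by apply: (Ck_on_eq oU _ (Ck_on_cst k U 0)) => x _; rewrite big_nil.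
by apply: (Ck_on_eq oU _ (Ck_onD oU (fk i) IHr)) => x _; rewrite big_cons.
Qed.

Lemma Ck_on_bilinear V W m n k (U : set V)
    (b : 'rV[R]_m.+1 -> 'rV[R]_n.+1 -> W) f g :
  (forall y, linear (b^~ y)) -> (forall y, linear (b y)) -> open U ->
  Ck_on k U f -> Ck_on k U g -> Ck_on k U (fun x => b (f x) (g x)).
Proof.
move=> bl br oU; elim: k f g => [|k IHk] f g.
  move=> fc gc x Ux; have [b' ->] := mk_bilinear bl br.
  apply: (@continuous_comp _ _ _ (fun x => (f x, g x)) (fun p => b' p.1 p.2)).
    exact: cvg_pair (fc x Ux) (gc x Ux).
  exact: rV_bilinear_continuous.
move=> Cf Cg; have [[df Df] [dg Dg]] := (Cf, Cg); split=> [x Ux|v].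
  by have [] := diff_bilinear_comp bl br (df x Ux) (dg x Ux).
apply: (Ck_on_eq oU _ (Ck_onD oU (IHk _ _ (Df v) (Ck_onW Cg))
  (IHk _ _ (Ck_onW Cf) (Dg v)))) => x Ux.
have [dfx dgx] := (df x Ux, dg x Ux).
by have [dfg E] := diff_bilinear_comp bl br dfx dgx; rewrite !deriveE // E.
Qed.

(** The summand of the chain rule in coordinates, as a bilinear map to which [Ck_on_bilinear]
    applies. *)
Definition scale_coord n m i (x : 'rV[R]_n) (y : 'rV[R]_m) : 'rV[R]_m := x 0 i *: y.

Lemma scale_coord_linear_l n m i (y : 'rV[R]_m) : linear ((@scale_coord n m i)^~ y).
Proof. by move=> a u v; rewrite /scale_coord !mxE scalerDl scalerA. Qed.

Lemma scale_coord_linear_r n m i (x : 'rV[R]_n) : linear (@scale_coord n m i x).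
Proof. by move=> a u v; rewrite /scale_coord scalerDr !scalerA mulrC. Qed.

Lemma derive_comp V W m (f : 'rV[R]_m.+1 -> W) (g : V -> 'rV[R]_m.+1) x v :
  differentiable g x -> differentiable f (g x) ->
  'D_v (f \o g) x = \sum_i 'D_v g x 0 i *: 'D_(delta_mx 0 i) f (g x).
Proof.
move=> dg df.
have -> : 'D_v (f \o g) x = 'd f (g x) ('D_v g x).
  by rewrite (deriveE _ (differentiable_comp dg df)) diff_comp // (deriveE _ dg).
transitivity (\sum_i 'D_v g x 0 i *: 'd f (g x) (delta_mx 0 i)).
  move: ('D_v g x) ('d f (g x)) => w L.
  rewrite {1}(row_sum_delta w) linear_sum.
  by apply: eq_bigr => i _; rewrite linearZ.
by apply: eq_bigr => i _; rewrite (deriveE _ df).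
Qed.

(** Induction on [k]: by the chain rule a derivative of the composite is a sum of products of
    derivatives of [g] with composites of derivatives of [f]. *)
Lemma Ck_on_comp V m n k (U : set V) (U' : set 'rV[R]_m.+1)
    (f : 'rV[R]_m.+1 -> 'rV[R]_n.+1) (g : V -> 'rV[R]_m.+1) :
  open U -> (forall x, U x -> U' (g x)) ->
  Ck_on k U g -> Ck_on k U' f -> Ck_on k U (f \o g).
Proof.
move=> oU UU'; elim: k f => [|k IHk] f.
  by move=> gc fc x Ux; exact: continuous_comp (gc x Ux) (fc _ (UU' x Ux)).
move=> Cg; have [dg Dg] := Cg; move=> [df Df]; split=> [x Ux|v].
  by apply: differentiable_comp; [apply: dg|apply/df/UU'].
have Ci i : Ck_on k U (fun x => scale_coord i ('D_v g x) ('D_(delta_mx 0 i) f (g x))).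
  apply: (Ck_on_bilinear _ _ oU (Dg v) (IHk _ (Ck_onW Cg) (Df _))).
    exact: scale_coord_linear_l.
  exact: scale_coord_linear_r.
apply: (Ck_on_eq oU _ (Ck_on_sum _ oU Ci)) => x Ux.
by rewrite derive_comp //; [apply: dg|apply/df/UU'].
Qed.

Lemma derive_comm V n (f : V -> 'rV[R]_n.+1) (U : set V) x u v :
  open U -> U x -> Ck_on 2 U f ->
  'D_v (fun y => 'D_u f y) x = 'D_u (fun y => 'D_v f y) x.
Proof.
move=> oU Ux [df Df]; apply/rowP => i.
have coord (g : V -> 'rV[R]_n.+1) y w : differentiable g y ->
    is_derive y w (fun t => g t 0 i) ('D_w g y 0 i).
  move=> dg; have dgw : derivable g y w by apply: diff_derivable.
  split; last by rewrite derive_mx // mxE.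
  by have /derivable_mxP := dgw.
have cont w w' : {for x, continuous (fun y => 'D_w' (fun y => 'D_w f y) y 0 i)}.
  have [_ D2] := Df w.
  apply: (@continuous_comp _ _ _ (fun y => 'D_w' (fun y => 'D_w f y) y)
    (fun M : 'rV[R]_n.+1 => M 0 i)).
    exact: D2.
  exact: coord_continuous.
apply: (@mixed_derivatives _ _ (fun t => f t 0 i) (fun t => 'D_u f t 0 i)
  (fun t => 'D_v f t 0 i) (fun y => 'D_v (fun y => 'D_u f y) y 0 i)
  (fun y => 'D_u (fun y => 'D_v f y) y 0 i) x u v).
- have := open_nbhs_nbhs (conj oU Ux); apply: filterS => y Uy.
  have [Du _] := Df u; have [Dv _] := Df v.
  by split; apply: coord; [apply: df|apply: df|apply: Du|apply: Dv].
- exact: cont.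
- exact: cont.
Qed.

Lemma diff_bilinear_eq0 m n V W (b : 'rV[R]_m.+1 -> 'rV[R]_n.+1 -> W)
    (f : V -> 'rV[R]_m.+1) (g : V -> 'rV[R]_n.+1) x v :
  (forall y, linear (b^~ y)) -> (forall y, linear (b y)) ->
  differentiable f x -> differentiable g x ->
  (\forall y \near x, b (f y) (g y) = 0) ->
  b ('d f x v) (g x) + b (f x) ('d g x v) = 0.
Proof.
move=> bl br df dg bfg; have [dfg <-] := diff_bilinear_comp bl br df dg.
have [_ ->] : differentiable (fun y => b (f y) (g y)) x /\
    'd (fun y => b (f y) (g y)) x = 'd (cst (0 : W)) x :> (V -> W).
  apply: near_eq_diff; last exact: differentiable_cst.
  by apply: filterS bfg => y ->.
by rewrite diff_cst.
Qed.

Lemma derive_bilinear_eq0 m n V W (b : 'rV[R]_m.+1 -> 'rV[R]_n.+1 -> W)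
    (f : V -> 'rV[R]_m.+1) (g : V -> 'rV[R]_n.+1) x v :
  (forall y, linear (b^~ y)) -> (forall y, linear (b y)) ->
  differentiable f x -> differentiable g x ->
  (\forall y \near x, b (f y) (g y) = 0) ->
  b ('D_v f x) (g x) + b (f x) ('D_v g x) = 0.
Proof.
move=> bl br df dg bfg; rewrite (deriveE v df) (deriveE v dg).
exact: diff_bilinear_eq0 bl br df dg bfg.
Qed.

Lemma collinear_solve n (f' g' y : 'rV[R]_n) k j : y 0 j != 0 ->
  y 0 j *: f' - f' 0 j *: y + (g' 0 j *: (k *: y) - (k *: y) 0 j *: g') = 0 ->
  exists a b, f' = a *: y + b *: g'.
Proof.
move=> yj E; exists ((f' 0 j - k * g' 0 j) / y 0 j), k.
apply: (scalerI yj); rewrite scalerDr !scalerA mulrCA divff // mulr1.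
apply/eqP; rewrite -subr_eq0; apply/eqP; rewrite -[RHS]E.
by apply/rowP => i; rewrite !mxE; ring.
Qed.

(** The factor of proportionality is never differentiated. Collinearity is the vanishing of a
    bilinear expression; with [j] a nonzero coordinate of [g x], its derivative can be solved for
    that of [f]. *)
Lemma diff_collinear n V (f g : V -> 'rV[R]_n.+1) x v :
  differentiable f x -> differentiable g x -> g x != 0 ->
  (\forall y \near x, exists k, f y = k *: g y) ->
  exists a b, 'd f x v = a *: g x + b *: 'd g x v.
Proof.
move=> df dg gx fg.
have [j gj] : exists j, g x 0 j != 0.
  apply/existsP; rewrite -negb_forall; apply/negP => /forallP g0.
  by case/eqP: gx; apply/rowP => j; rewrite (eqP (g0 j)) mxE.
pose b (y z : 'rV[R]_n.+1) := z 0 j *: y - y 0 j *: z.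
have bl z : linear (b^~ z).
  by move=> a y y'; rewrite /b !mxE; apply/rowP => i; rewrite !mxE; ring.
have br z : linear (b z).
  by move=> a y y'; rewrite /b !mxE; apply/rowP => i; rewrite !mxE; ring.
have : \forall y \near x, b (f y) (g y) = 0.
  by apply: filterS fg => y [k ->]; apply/rowP => i; rewrite !mxE; ring.
move=> /(diff_bilinear_eq0 v bl br df dg).
have [k ->] := nbhs_singleton fg; rewrite /b.
by move=> E; exact: collinear_solve gj E.
Qed.

End Smoothness.

(** * Lifts in charts *)

Lemma line_generator (R : realType) (l : {vspace 'rV[R]_8}) :
  \dim l = 1%N -> exists2 y, y != 0 & l = <[y]>%VS.
Proof.
move=> dl; have l0 : l != 0%VS by rewrite -dimv_eq0 dl.
exists (vpick l); first by rewrite vpick0.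
apply/esym/eqP; rewrite eqEdim -memvE memv_pick dl dim_vline.
by rewrite vpick0 l0.
Qed.

Lemma vlineZ (R : realType) (y : 'rV[R]_8) k : k != 0 -> <[k *: y]>%VS = <[y]>%VS.
Proof.
move=> k0; apply/eqP; rewrite eqEsubv -!memvE memvZ ?memv_line //=.
by apply/vlineP; exists k^-1; rewrite scalerA mulVf // scale1r.
Qed.

Section Surface.
Context {R : realType} {S : smooth_surface R}.
Implicit Types (phi : S -> {vspace 'rV[R]_8}) (psi : S -> 'rV[R]_8)
  (c d : chart R S) (U : set S) (p q : S).

Lemma chart_image_open c U : open U -> open (cmap c @` (cdom c `&` U)).
Proof.
move=> oU; rewrite openE => _ [p [cp Up] <-].
have cimg : (cmap c @` cdom c) (cmap c p) by exists p.
have near1 := open_nbhs_nbhs (conj (@cimg_open _ _ c) cimg).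
have near2 : \forall t \near cmap c p, (cdom c `&` U) (cinv c t).
  apply: (cinv_cont cimg); rewrite cmapK //.
  exact: open_nbhs_nbhs (conj (openI (@cdom_open _ _ c) oU) (conj cp Up)).
rewrite /interior; apply: filterS2 near1 near2 => t [q cq <-]; rewrite cmapK // => cUq.
Qed.

Lemma near_chart_image c U p : open U -> cdom c p -> U p ->
  \forall t \near cmap c p, (cmap c @` (cdom c `&` U)) t.
Proof.
move=> oU cp Up; apply: open_nbhs_nbhs; split; first exact: chart_image_open.
by exists p.
Qed.

Lemma lift_differentiable phi U psi c p : local_lift phi U psi -> atlas c ->
  cdom c p -> U p -> differentiable (psi \o cinv c : 'rV[R]_2 -> 'rV[R]_8) (cmap c p).
Proof.
by move=> [_ sm _] ac cp Up; have [d _] := sm c ac 1%N; apply: d; exists p.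
Qed.

Lemma sdiffD c psi p w w' : sdiff c psi p (w + w') = sdiff c psi p w + sdiff c psi p w'.
Proof. by rewrite /sdiff linearD. Qed.

Lemma sdiffZ c psi p a w : sdiff c psi p (a *: w) = a *: sdiff c psi p w.
Proof. by rewrite /sdiff linearZ. Qed.

Lemma sdiff_basis c psi p w : sdiff c psi p w =
  w 0 0 *: sdiff c psi p (delta_mx 0 0) + w 0 1 *: sdiff c psi p (delta_mx 0 1).
Proof.
have E1 : lift ord0 ord0 = 1 :> 'I_2 by apply: val_inj.
by rewrite {1}(row_sum_delta w) !big_ord_recl big_ord0 addr0 E1 sdiffD !sdiffZ.
Qed.

Lemma sdiff_chart phi U psi c d p w : local_lift phi U psi -> U p ->
    atlas c -> atlas d -> cdom c p -> cdom d p ->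
  exists w', sdiff d psi p w = sdiff c psi p w'.
Proof.
move=> lpsi Up ac ad cp dp.
have dc := lift_differentiable lpsi ac cp Up.
have [dg _] := atlas_compat ad ac 1%N.
have dgp : differentiable (cmap c \o cinv d : 'rV[R]_2 -> 'rV[R]_2) (cmap d p).
  by apply: dg; exists p.
have gp : (cmap c \o cinv d) (cmap d p) = cmap c p by rewrite /= cmapK.
rewrite -gp in dc.
exists ('d (cmap c \o cinv d : 'rV[R]_2 -> 'rV[R]_2) (cmap d p) w); rewrite /sdiff.
have E : \forall t \near cmap d p,
    ((psi \o cinv c) \o (cmap c \o cinv d)) t = (psi \o cinv d) t.
  have := near_chart_image (@cdom_open _ _ c) dp cp.
  by apply: filterS => _ [q [dq cq] <-] /=; rewrite !cmapK.
have [_ Ed] := near_eq_diff E (differentiable_comp dgp dc).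
apply: (etrans (congr1 (@^~ w) Ed)).
apply: (etrans (congr1 (@^~ w) (diff_comp dgp dc))) => /=.
by rewrite cmapK.
Qed.

(** Two lifts of the same line are collinear near [p], so [diff_collinear] applies. *)
Lemma sdiff_lift phi U U' psi psi' c p w : local_lift phi U psi ->
    local_lift phi U' psi' -> U p -> U' p -> atlas c -> cdom c p ->
  exists a b, sdiff c psi' p w = a *: psi p + b *: sdiff c psi p w.
Proof.
move=> l1 l2 Up U'p ac cp.
have d1 := lift_differentiable l1 ac cp Up.
have d2 := lift_differentiable l2 ac cp U'p.
have gp : (psi \o cinv c) (cmap c p) = psi p by rewrite /= cmapK.
rewrite -gp; apply: diff_collinear => //.
  by rewrite gp; case: l1 => _ _ /(_ p Up)[].
have [oU _ l1E] := l1; have [oU' _ l2E] := l2.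
have := near_chart_image (openI oU oU') cp (conj Up U'p).
apply: filterS => _ [q [cq [Uq U'q]] <-] /=; rewrite cmapK //.
have [_ E1] := l1E q Uq; have [_ E2] := l2E q U'q.
by apply/vlineP; rewrite -E1 E2 memv_line.
Qed.

(** Lets V be computed in one fixed lift and one fixed chart. *)
Lemma lift_spaceP phi U U' psi psi' c p v : local_lift phi U psi ->
    local_lift phi U' psi' -> U p -> U' p -> atlas c -> cdom c p ->
  lift_space psi' p v -> exists a w, v = a *: psi p + sdiff c psi p w.
Proof.
move=> l1 l2 Up U'p ac cp [d [a [w [ad dp ->]]]].
have [w' ->] := sdiff_chart w l2 U'p ac ad cp dp.
have [a' [b ->]] := sdiff_lift w' l1 l2 Up U'p ac cp.
have : psi' p \in <[psi p]>%VS.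
  have [_ _ /(_ p Up)[_ <-]] := l1; have [_ _ /(_ p U'p)[_ ->]] := l2.
  exact: memv_line.
move=> /vlineP[k ->]; exists (a * k + a'), (b *: w').
by rewrite sdiffZ scalerDl scalerA addrA.
Qed.

Lemma lift_space_lift c psi p : atlas c -> cdom c p -> lift_space psi p (psi p).
Proof.
by move=> ac cp; exists c, 1, 0; split; rewrite // scale1r /sdiff linear0 addr0.
Qed.

Lemma lift_space_sdiff c psi p w : atlas c -> cdom c p ->
  lift_space psi p (sdiff c psi p w).
Proof. by move=> ac cp; exists c, 0, w; split; rewrite // scale0r add0r. Qed.

End Surface.

(** * The annihilator of a totally isotropic immersion *)

(** Alternating the two rules returns [T w a b] with the opposite sign, as in the uniqueness of the
    Levi-Civita connection. *)
Lemma sym_antisym_eq0 (R : realFieldType) (V : Type) (T : V -> V -> V -> R) :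
  (forall w a b, T w a b = T a w b) -> (forall w a b, T w a b = - T w b a) ->
  forall w a b, T w a b = 0.
Proof.
move=> sym anti w a b; have := anti w a b; have := anti a b w; have := anti b w a.
have := sym w a b; have := sym a b w; have := sym b w a; lra.
Qed.

Section PhiMinus.
Context {R : realType} (O : split_octonion R) {S : smooth_surface R}.
Implicit Types (phi : S -> {vspace 'rV[R]_8}) (psi : S -> 'rV[R]_8)
  (c d : chart R S) (U : set S) (p q : S).
Local Notation "x ** y" := (omul O x y) (at level 39, left associativity).
Local Notation N := (onorm O).
Local Notation B := (polar O).
Local Notation e0 := (delta_mx 0 0 : 'rV[R]_2).
Local Notation e1 := (delta_mx 0 1 : 'rV[R]_2).

Lemma tot_isotropic_norm phi U psi c p w : tot_isotropic_immersion O phi ->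
    local_lift phi U psi -> U p -> atlas c -> cdom c p ->
  N (psi p) = 0 /\ N (sdiff c psi p w) = 0.
Proof.
move=> [_ _ iso] l Up ac cp; split; apply: (iso _ _ _ l Up).
  exact: lift_space_lift ac cp.
exact: lift_space_sdiff.
Qed.

Lemma tot_isotropic_polar phi U psi c p w w' : tot_isotropic_immersion O phi ->
    local_lift phi U psi -> U p -> atlas c -> cdom c p ->
  B (psi p) (sdiff c psi p w) = 0 /\ B (sdiff c psi p w) (sdiff c psi p w') = 0.
Proof.
move=> tii l Up ac cp.
have NE w0 := tot_isotropic_norm w0 tii l Up ac cp.
split; rewrite /polar.
  have -> : N (psi p + sdiff c psi p w) = 0.
    have [_ _ /(_ _ _ _ l Up)] := tii; apply.
    by exists c, 1, w; split; rewrite // scale1r.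
  by rewrite (NE w).1 (NE w).2 !subr0.
by rewrite -sdiffD !(NE _).2 !subr0.
Qed.

Lemma tot_isotropic3 phi U psi c p : tot_isotropic_immersion O phi ->
    local_lift phi U psi -> U p -> atlas c -> cdom c p ->
  isotropic3 O (psi p) (sdiff c psi p e0) (sdiff c psi p e1).
Proof.
move=> tii l Up ac cp.
have NE w := tot_isotropic_norm w tii l Up ac cp.
have BE w w' := tot_isotropic_polar w w' tii l Up ac cp.
by split; [apply: (NE 0).1|apply: (NE _).2|apply: (NE _).2|apply: (BE _ 0).1|
  split; [apply: (BE _ 0).1|apply: (BE _ _).2]].
Qed.

Lemma immersion_free3 phi U psi c p : immersion phi ->
    local_lift phi U psi -> U p -> atlas c -> cdom c p ->
  free3 (psi p) (sdiff c psi p e0) (sdiff c psi p e1).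
Proof.
move=> [_ imm] l Up ac cp a b b' E.
pose w : 'rV[R]_2 := b *: e0 + b' *: e1.
(* The relation puts the derivative along [w] in the line of [psi p], which forces [w = 0]. *)
have wE : sdiff c psi p w = (- a) *: psi p.
  rewrite /w sdiffD !sdiffZ scaleNr; apply/eqP.
  by rewrite -addr_eq0 addrC addrA E.
have w0 : w = 0.
  by apply: (imm p U psi c w) => //; rewrite wE memvZ ?memv_line.
have := congr1 (fun v : 'rV[R]_2 => (v 0 0, v 0 1)) w0.
rewrite /w !mxE /= !mulr0 !mulr1 addr0 add0r => -[b0 b'0]; rewrite b0 b'0; split=> //.
move: E; rewrite b0 b'0 !scale0r !addr0 => /eqP.
by have [_ _ /(_ p Up)[/negPf p0 _]] := l; rewrite scaler_eq0 p0 orbF => /eqP.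
Qed.

(** The choice made by [xget] is forced: by [spinor_unique], generators of any two candidate lines
    are multiples of one spinor. *)
Lemma phi_minus_eq phi U psi c p y : tot_isotropic_immersion O phi ->
    local_lift phi U psi -> U p -> atlas c -> cdom c p -> y != 0 ->
    psi p ** y = 0 -> (forall w, sdiff c psi p w ** y = 0) ->
  phi_minus O phi p = <[y]>%VS.
Proof.
move=> tii l Up ac cp y0 py dy; have [_ imm _] := tii.
have [_ _ /(_ p Up)[psi0 _]] := l.
have [u u0 uni] := spinor_unique (tot_isotropic3 tii l Up ac cp)
  (immersion_free3 imm l Up ac cp).
apply: xget_unique.
  split; first split.
  - by rewrite dim_vline y0.
  - by move=> _ /vlineP[k ->]; rewrite onormZ (onorm_mul0r py psi0) mulr0.
  - move=> _ U' psi' /vlineP[k ->] l' U'p v /(lift_spaceP l l' Up U'p ac cp)[a [w ->]].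
    by rewrite linearZ /= omulDl omulZl py dy scaler0 addr0 scaler0.
move=> _ [[/line_generator[y' y'0 ->] _] ann].
have annp := ann y' U psi (memv_line _) l Up.
have [k' y'E] : exists k, y' =
    k *: spinor O (psi p) (sdiff c psi p e0) (sdiff c psi p e1) u.
  apply: uni; apply: annp; [exact: lift_space_lift ac cp | exact: lift_space_sdiff..].
have [k yE] := uni y py (dy _) (dy _).
move: y0 y'0; rewrite {}yE {}y'E !scaler_eq0 !negb_or => /andP[k0 _] /andP[k'0 _].
by rewrite !vlineZ.
Qed.

(** Conjugation is absorbed into the product, so that the rules for bilinear maps apply to each
    factor of [spinor]. *)
Let conj_mul x y := oconj O x ** y.

Let conj_mul_linear_l y : linear (conj_mul^~ y).
Proof. by move=> a x x'; rewrite /conj_mul oconjD oconjZ omulDl omulZl. Qed.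

Let conj_mul_linear_r x : linear (conj_mul x).
Proof. exact: omul_linear_r. Qed.

Lemma diff_spinor (V : normedModType R) (f0 f1 f2 : V -> 'rV[R]_8) u t w :
  differentiable f0 t -> differentiable f1 t -> differentiable f2 t ->
  'd (fun t => spinor O (f0 t) (f1 t) (f2 t) u) t w =
  spinor O ('d f0 t w) (f1 t) (f2 t) u + spinor O (f0 t) ('d f1 t w) (f2 t) u +
  spinor O (f0 t) (f1 t) ('d f2 t w) u.
Proof.
move=> d0 d1 d2.
have step (b : 'rV[R]_8 -> 'rV[R]_8 -> 'rV[R]_8) f g df dg :
    (forall y, linear (b^~ y)) -> (forall y, linear (b y)) ->
    differentiable f t -> differentiable g t -> 'd f t w = df -> 'd g t w = dg ->
    differentiable (fun t : V => b (f t) (g t)) t /\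
    'd (fun t => b (f t) (g t)) t w = b df (g t) + b (f t) dg.
  move=> bl br df_ dg_ <- <-; have [d E] := diff_bilinear_comp bl br df_ dg_.
  by split.
have cl := conj_mul_linear_l; have cr := conj_mul_linear_r.
have [dm2 E2] := step _ _ _ _ _ cl cr d2 (differentiable_cst u t) erefl
  (congr1 (@^~ w) (diff_cst u t)).
have [dm1 E1] := step _ _ _ _ _ (omul_linear_l O) (omul_linear_r O) d1 dm2 erefl E2.
have [_ E0] := step _ _ _ _ _ cl cr d0 dm1 erefl E1.
have alg k0 k1 k2 x0 x1 x2 :
    conj_mul k0 (x1 ** conj_mul x2 u) +
      conj_mul x0 (k1 ** conj_mul x2 u + x1 ** (conj_mul k2 u + conj_mul x2 0)) =
    spinor O k0 x1 x2 u + spinor O x0 k1 x2 u + spinor O x0 x1 k2 u.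
  have mul0 x : x ** 0 = 0 by apply: linear0.
  by rewrite /spinor /conj_mul mul0 addr0 !linearD /= addrA.
exact: etrans E0 (alg _ _ _ _ _ _).
Qed.

(** In the outer terms [z] kills the first two slots. In the middle term it kills the first and
    third, and [k1] is orthogonal to [x2], so these two slots can be exchanged. *)
Lemma spinor_variation_ker x0 x1 x2 k0 k1 k2 u z :
    z ** x0 = 0 -> z ** x1 = 0 -> z ** x2 = 0 -> z ** k0 = 0 -> B k1 x2 = 0 ->
  (spinor O k0 x1 x2 u + spinor O x0 k1 x2 u + spinor O x0 x1 k2 u) ** z = 0.
Proof.
move=> z0 z1 z2 zk0 k12; rewrite !omulDl (spinor_mul_swap u k12 z0 z2) addr0.
by rewrite /spinor !spinor_mul_ker // addr0.
Qed.

(** * A smooth lift of phi_- in a chart *)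

Section LocalSpinor.
Context {phi : S -> {vspace 'rV[R]_8}} {U : set S} {psi : S -> 'rV[R]_8} {c : chart R S}.
Hypotheses (tii : tot_isotropic_immersion O phi) (l : local_lift phi U psi)
  (ac : atlas c).
Let X := psi \o cinv c : 'rV[R]_2 -> 'rV[R]_8.
Let D := cmap c @` (cdom c `&` U).

(** The seed [u] is constant along the chart; it is chosen to make the spinor nonzero at one point,
    hence near it. *)
Definition chart_spinor u (t : 'rV[R]_2) :=
  spinor O (X t) ('D_e0 X t) ('D_e1 X t) u.

Let oU : open U. Proof. by case: l. Qed.

Let oD : open D. Proof. exact: chart_image_open. Qed.

Let X_smooth k : Ck_on k D X.
Proof. by have [_ sm _] := l; apply: sm. Qed.

Let X_diff t : D t -> differentiable X t.
Proof. by have [d _] := X_smooth 1; apply: d. Qed.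

Let DX_diff w t : D t -> differentiable (fun t => 'D_w X t) t.
Proof. by have [_ /(_ w) [d _]] := X_smooth 2; apply: d. Qed.

Let X_cmap p : cdom c p -> X (cmap c p) = psi p.
Proof. by move=> cp; rewrite /X /= cmapK. Qed.

Let DX_cmap p w : cdom c p -> U p -> 'D_w X (cmap c p) = sdiff c psi p w.
Proof. by move=> cp Up; rewrite deriveE //; apply: X_diff; exists p. Qed.

Lemma chart_spinor_smooth u k : Ck_on k D (chart_spinor u).
Proof.
apply: (Ck_on_bilinear conj_mul_linear_l conj_mul_linear_r) => //.
apply: (Ck_on_bilinear (omul_linear_l O) (omul_linear_r O)) => //.
  (* The spinor contains first derivatives of [X], which costs one order of smoothness. *)
  by have [_] := X_smooth k.+1; apply.
apply: (Ck_on_bilinear conj_mul_linear_l conj_mul_linear_r) => //.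
  by have [_] := X_smooth k.+1; apply.
exact: Ck_on_cst.
Qed.

Let phi_minus_chart_spinor u p : cdom c p -> U p -> chart_spinor u (cmap c p) != 0 ->
  phi_minus O phi p = <[chart_spinor u (cmap c p)]>%VS.
Proof.
move=> cp Up y0; move: (y0); rewrite /chart_spinor X_cmap // !DX_cmap // => y0'.
have [k0 k1 k2] := spinor_ker u (tot_isotropic3 tii l Up ac cp).
apply: (phi_minus_eq tii l Up ac cp) => // w.
by rewrite sdiff_basis omulDl !omulZl k1 k2 !scaler0 addr0.
Qed.

Lemma phi_minus_lift p : cdom c p -> U p -> exists u U',
  [/\ U' p, U' `<=` cdom c `&` U &
      local_lift (phi_minus O phi) U' (chart_spinor u \o cmap c)].
Proof.
move=> cp Up; have [_ imm _] := tii.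
have [u u0 _] := spinor_unique (tot_isotropic3 tii l Up ac cp)
  (immersion_free3 imm l Up ac cp).
exists u; exists [set q | (cdom c `&` U) q /\ chart_spinor u (cmap c q) != 0].
split=> [|q []//|].
  by split=> //; rewrite /chart_spinor X_cmap // !DX_cmap.
split=> [|d ad k|q [[cq Uq] q0]]; last first.
- by split=> //; apply: phi_minus_chart_spinor.
- have sub : cmap d @` (cdom d `&`
        [set q | (cdom c `&` U) q /\ chart_spinor u (cmap c q) != 0])
      `<=` cmap d @` (cdom d `&` (cdom c `&` U)).
    by move=> _ [q [dq [cUq _]] <-]; exists q.
  apply: (Ck_on_sub sub).
  (* In another chart [d], the spinor of the chart [c] is composed with the transition map. *)
  rewrite -[_ \o cinv d]/(chart_spinor u \o (cmap c \o cinv d)).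
  apply: (Ck_on_comp (U' := D)); last exact: chart_spinor_smooth.
  + by apply: chart_image_open; apply: openI => //; apply: cdom_open.
  + by move=> _ [q [dq [cq Uq]] <-]; rewrite /= cmapK //; exists q.
  + apply: Ck_on_sub (atlas_compat ad ac k).
    by move=> _ [q [dq [cq Uq]] <-]; exists q.
rewrite openE => q [[cq Uq] q0].
have near_cU := open_nbhs_nbhs (conj (openI (@cdom_open _ _ c) oU) (conj cq Uq)).
have near_y : \forall q' \near q, chart_spinor u (cmap c q') != 0.
  have cont : {for q, continuous (chart_spinor u \o cmap c)}.
    apply: continuous_comp; first exact: cmap_cont.
    by apply: (chart_spinor_smooth u 0); exists q.
  exact: cvgr_neq0 cont q0.
by rewrite /interior; apply: filterS2 near_cU near_y.
Qed.

(** As a trilinear expression this is symmetric in [w], [a] by commuting derivatives, and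
    antisymmetric in [a], [b] by differentiating the isotropy of the first derivatives. *)
Lemma second_derivatives_orthogonal a b w t : D t ->
  B ('D_w (fun t => 'D_a X t) t) ('D_b X t) = 0.
Proof.
move=> Dt; pose T w a b := B ('D_w (fun t => 'D_a X t) t) ('D_b X t).
have Tsym w' a' b' : T w' a' b' = T a' w' b'.
  have E := derive_comm a' w' oD Dt (X_smooth 2).
  have aux (v v' y : 'rV[R]_8) : v = v' -> B v y = B v' y by move->.
  rewrite /T; apply: aux. exact: E.
have Tanti w' a' b' : T w' a' b' = - T w' b' a'.
  have bl y : linear (fun x => B x y : R^o) by move=> k x x'; rewrite polarDl polarZl.
  have br y : linear (fun x => B y x : R^o) by move=> k x x'; rewrite polarDr polarZr.
  have da := DX_diff a' Dt; have db := DX_diff b' Dt.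
  have Bab : \forall t \near t, B ('D_a' X t) ('D_b' X t) = 0.
    have := open_nbhs_nbhs (conj oD Dt); apply: filterS => _ [p [cp Up] <-].
    by rewrite !DX_cmap // (tot_isotropic_polar a' b' tii l Up ac cp).2.
  have E := derive_bilinear_eq0 w' bl br da db Bab.
  by apply/eqP; rewrite -addr_eq0 /T [X in _ + X]polarC; apply/eqP; exact: E.
exact: (sym_antisym_eq0 Tsym Tanti w a b).
Qed.

Lemma chart_spinor_ker u p z : cdom c p -> U p -> z ** psi p = 0 ->
    (forall w, z ** sdiff c psi p w = 0) ->
  chart_spinor u (cmap c p) ** z = 0 /\
  forall w, 'd (chart_spinor u) (cmap c p) w ** z = 0.
Proof.
move=> cp Up zp zd; have Dt : D (cmap c p) by exists p.
split=> [|w].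
  by rewrite /chart_spinor X_cmap // !DX_cmap // spinor_mul_ker.
have [dX dX0 dX1] := And3 (X_diff Dt) (DX_diff e0 Dt) (DX_diff e1 Dt).
have E := diff_spinor u w dX dX0 dX1.
apply: (etrans (congr1 (omul O ^~ z) E)); apply: spinor_variation_ker.
- by rewrite X_cmap.
- by rewrite DX_cmap.
- by rewrite DX_cmap.
- exact: zd.
- by rewrite -(deriveE w dX0); apply: second_derivatives_orthogonal.
Qed.

(** Transfers [chart_spinor_ker] to an arbitrary lift. Taking for [z] a generator of phi_+ gives the
    incidence of phi_- with phi_+ and the tangency condition at index 1. *)
Lemma phi_minus_lift_ker U' psi' p z w : cdom c p -> U p ->
    local_lift (phi_minus O phi) U' psi' -> U' p ->
    z ** psi p = 0 -> (forall w, z ** sdiff c psi p w = 0) ->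
  psi' p ** z = 0 /\ sdiff c psi' p w ** z = 0.
Proof.
move=> cp Up l' U'p zp zd.
have [u [U1 [U1p _ l1]]] := phi_minus_lift cp Up.
have [y0 dy] := chart_spinor_ker u cp Up zp zd.
split.
  have [_ _ /(_ p U1p)[_ E1]] := l1; have [_ _ /(_ p U'p)[_ E2]] := l'.
  have /vlineP[k ->] : psi' p \in <[chart_spinor u (cmap c p)]>%VS.
    by rewrite -E1 E2 memv_line.
  by rewrite omulZl y0 scaler0.
have [a [b ->]] := sdiff_lift w l1 l' U1p U'p ac cp.
rewrite omulDl !omulZl /= y0 scaler0 add0r.
have -> : sdiff c (chart_spinor u \o cmap c) p w = 'd (chart_spinor u) (cmap c p) w.
  have [dY _] := chart_spinor_smooth u 1.
  have E : \forall t \near cmap c p,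
      chart_spinor u t = ((chart_spinor u \o cmap c) \o cinv c) t.
    have := near_chart_image oU cp Up.
    by apply: filterS => _ [q [cq _] <-] /=; rewrite cmapK.
  have [|_ Ed] := near_eq_diff E; first by apply: dY; exists p.
  by rewrite /sdiff; move: Ed => /(congr1 (fun h : _ -> _ => h w)).
exact: etrans (congr1 ( *:%R b) (dy w)) (scaler0 _ b).
Qed.

End LocalSpinor.
End PhiMinus.

(** * The incidence variety *)

Lemma Z3_cases (i j : 'Z_3) : [\/ j = i, j = i + 1 | j = i - 1].
Proof.
by case: i => [[|[|[|]]]] // ?; case: j => [[|[|[|]]]] // ?;
  by [constructor 1; apply: val_inj|constructor 2; apply: val_inj|
      constructor 3; apply: val_inj].
Qed.

(** The third index is written [1 + 1], the form that [i + 1] takes at [i = 1]. *)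
Lemma Z3_ind (P : 'Z_3 -> Prop) : P 0 -> P 1 -> P (1 + 1) -> forall i, P i.
Proof.
move=> P0 P1 P2 i; have [->|->|->] := Z3_cases 0 i; rewrite ?add0r //.
by have -> : - 1 = 1 + 1 :> 'Z_3 by apply: val_inj.
Qed.

Lemma Z3_neq_shift (k : 'Z_3) : (k == k + 1) = false /\ (k == k - 1) = false.
Proof. by move: k; apply: Z3_ind. Qed.

Section Tangent.
Context {R : realType} (O : split_octonion R).
Implicit Types x v : 'Z_3 -> 'rV[R]_8.
Local Notation "x ** y" := (omul O x y) (at level 39, left associativity).

Lemma Ck_on_affine (W : set R^o) k (a b : 'rV[R]_8) :
  Ck_on k W (fun t : R^o => a + t *: b) /\
  forall s t : R^o, 'D_s (fun t : R^o => a + t *: b) t = s *: b.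
Proof.
have E : (fun t : R^o => a + t *: b) = cst a + ( *:%R ^~ b) :> (R^o -> _) by [].
have df (t : R^o) : differentiable (fun t : R^o => a + t *: b) t.
  by rewrite E; apply: differentiableD.
have D (s t : R^o) : 'D_s (fun t : R^o => a + t *: b) t = s *: b.
  have ds : is_diff t ( *:%R ^~ b : R^o -> _) ( *:%R ^~ b) by exact: is_diff_scalel.
  rewrite E deriveD; [|exact: derivable_cst|exact: diff_derivable].
  rewrite derive_cst add0r deriveE //.
  by have /(congr1 (fun h : _ -> _ => h s)) := @diff_val _ _ _ _ _ _ _ ds.
split=> //; case: k => [|k].
  by move=> t _; apply: differentiable_continuous.
split=> [t _|s]; first exact: df.
have -> : (fun t => 'D_s (fun t : R^o => a + t *: b) t) = fun=> s *: b.
  by apply/funext => t; apply: D.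
exact: Ck_on_cst.
Qed.

(** Isotropy follows from the products: a left factor that annihilates a nonzero vector has norm
    zero. *)
Lemma incidence_line x : incidence O (fun i => <[x i]>%VS) <->
  (forall i, x i != 0) /\ forall i, x i ** x (i + 1) = 0.
Proof.
split=> [[qx ax]|[x0 xx]].
  split=> i; last by apply: ax; apply: memv_line.
  by have [+ _] := qx i; rewrite dim_vline; case: (x i != 0).
split=> i.
  split; first by rewrite dim_vline x0.
  by move=> _ /vlineP[k ->]; rewrite onormZ (onorm_mul0l (xx i)) ?mulr0.
move=> _ _ /vlineP[k ->] /vlineP[l ->].
by rewrite omulZl linearZ /= xx !scaler0.
Qed.

Lemma TI_mul x v i : TI O x v -> v i ** x (i + 1) + x i ** v (i + 1) = 0.
Proof.
move=> [W [g [[oW W0] sm inc gx gv]]].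
have dg j : differentiable (g j) 0 by have [d _] := sm j 1%N; apply: d.
have near_g : \forall t \near (0 : R^o), g i t ** g (i + 1) t = 0.
  have := open_nbhs_nbhs (conj oW W0); apply: filterS => t Wt.
  by have [_ ] := (incidence_line _).1 (inc t Wt); apply.
have := @derive_bilinear_eq0 R _ _ R^o _ (omul O) (g i) (g (i + 1)) 0 1
  (omul_linear_l O) (omul_linear_r O) (dg i) (dg (i + 1)) near_g.
by rewrite -!derive1E !gv !gx.
Qed.

(* The straight curve t |-> x + t v stays in the incidence variety. *)
Lemma TI_single x v i : incidence O (fun i => <[x i]>%VS) ->
    v (i + 1) \in <[x (i + 1)%R]>%VS -> v (i - 1) \in <[x (i - 1)%R]>%VS ->
    x (i - 1) ** v i = 0 -> v i ** x (i + 1) = 0 -> TI O x v.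
Proof.
move=> /incidence_line[x0 xx] vS vP xv vx.
have line j : j = i \/ v j \in <[x j]>%VS.
  by have [->|->|->] := Z3_cases i j; [left|right|right].
have xvS j : x j ** v (j + 1) = 0.
  have [ji|/vlineP[k ->]] := line (j + 1); last by rewrite linearZ /= xx scaler0.
  by rewrite ji -(addrK 1 j) ji.
have vSx j : v j ** x (j + 1) = 0.
  by have [->//|/vlineP[k ->]] := line j; rewrite omulZl xx scaler0.
have vSv j : v j ** v (j + 1) = 0.
  have [->|/vlineP[k ->]] := line j; last by rewrite omulZl xvS scaler0.
  by have /vlineP[k ->] := vS; rewrite linearZ /= vx scaler0.
pose g j (t : R^o) := x j + t *: v j.
have gS k (W : set R^o) j := (@Ck_on_affine W k (x j) (v j)).
have g0 j : g j 0 = x j by rewrite /g scale0r addr0.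
(* The curve is restricted to the open set of times at which no component vanishes. *)
exists [set t : R^o | forall j, g j t != 0], g; split=> [|j k|t gt|//|j].
- split=> [|j]; last by rewrite g0.
  rewrite openE => t gt; rewrite /interior.
  have : \forall s \near t, forall j, g j s != 0.
    apply: (@filter_forall _ _ (fun j s => g j s != 0) (nbhs t) _) => j.
    have cont : {for t, continuous (g j)} by have [/(_ t I)] := gS 0%N setT j.
    exact: cvgr_neq0 cont (gt j).
  exact.
- exact: (gS k _ j).1.
- apply/incidence_line; split=> // j.
  rewrite /g omulDl omulZl !linearD !linearZ /= xx xvS vSx vSv.
  by rewrite !scaler0 !addr0.
- by rewrite derive1E (gS 0%N setT j).2 scale1r.
Qed.

Lemma omul_suml (I : Type) (r : seq I) (f : I -> 'rV[R]_8) y :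
  (\sum_(i <- r) f i) ** y = \sum_(i <- r) f i ** y.
Proof. by apply: (big_morph (omul O ^~ y)) => [a b|]; rewrite ?omulDl ?omul0l. Qed.

(** An element of the [k]-th summand moves only line [k], so in each relation [TI_mul] one product
    already vanishes. Conversely [v] splits into its components, each tangent by [TI_single]. *)
Lemma xiP x v : incidence O (fun i => <[x i]>%VS) ->
  xi O x v <-> forall i, v i ** x (i + 1) = 0 /\ x i ** v (i + 1) = 0.
Proof.
move=> inc; have /incidence_line[x0 xx] := inc; split=> [[w [xiw vE]] i|vx].
  have wx k : w k i ** x (i + 1) = 0.
    have [[Tw /vlineP[a wS]] [_ /vlineP[b wP]]] := xiw k.
    have [->|->|->] := Z3_cases k i.
    - have := TI_mul k Tw; rewrite wS linearZ /= xx scaler0 addr0; apply.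
    - by rewrite wS omulZl xx scaler0.
    - by rewrite wP omulZl xx scaler0.
  split; first by rewrite vE omul_suml big1.
  rewrite vE linear_sum big1 // => k _ /=.
  by have [[Tw _] _] := xiw k; have := TI_mul i Tw; rewrite wx add0r.
exists (fun k j => if k == j then v j else 0); split=> [k|j]; last first.
  by rewrite (bigD1 j) //= eqxx big1 ?addr0 // => k /negPf->.
have [kS kP] := Z3_neq_shift k.
have T : TI O x (fun j => if k == j then v j else 0).
  apply: (@TI_single _ _ k); rewrite ?eqxx ?kS ?kP ?mem0v //.
    by have [_] := vx (k - 1); rewrite subrK.
  by have [] := vx k.
by split; split; rewrite // ?kS ?kP mem0v.
Qed.

End Tangent.

(** * Facts for the forward and backward maps *)

Section Correspondence.
Context {R : realType} (O : split_octonion R) {S : smooth_surface R}.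
Implicit Types (phi : S -> {vspace 'rV[R]_8}) (psi : S -> 'rV[R]_8)
  (c : chart R S) (U : set S) (p q : S) (Phi : S -> 'Z_3 -> {vspace 'rV[R]_8}).
Local Notation "x ** y" := (omul O x y) (at level 39, left associativity).

Lemma local_lift_sub phi U U' psi : open U' -> U' `<=` U ->
  local_lift phi U psi -> local_lift phi U' psi.
Proof.
move=> oU' sub [_ sm l]; split=> // [c ac k|q /sub]; last exact: l.
by apply: Ck_on_sub (sm c ac k) => _ [q [cq /sub Uq] <-]; exists q.
Qed.

(** The definition involves the algebra only through its norm, which the opposite algebra shares. *)
Lemma tot_isotropic_opp phi : tot_isotropic_immersion O phi ->
  tot_isotropic_immersion (opp_octonion O) phi.
Proof. by []. Qed.

Lemma phi_minus_annihilator phi U psi c p : tot_isotropic_immersion O phi ->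
    local_lift phi U psi -> U p -> atlas c -> cdom c p ->
  exists y, [/\ y != 0, phi_minus O phi p = <[y]>%VS, psi p ** y = 0 &
    forall w, sdiff c psi p w ** y = 0].
Proof.
move=> tii l Up ac cp; have [_ imm _] := tii.
have iso := tot_isotropic3 tii l Up ac cp.
have [u y0 _] := spinor_unique iso (immersion_free3 imm l Up ac cp).
have [k0 k1 k2] := spinor_ker u iso.
have kd w : sdiff c psi p w ** spinor O (psi p) (sdiff c psi p (delta_mx 0 0))
    (sdiff c psi p (delta_mx 0 1)) u = 0.
  by rewrite sdiff_basis omulDl !omulZl k1 k2 !scaler0 addr0.
by eexists; split; [exact: y0|exact: (phi_minus_eq tii l Up ac cp)|..].
Qed.

Lemma phi_minus_smooth phi : tot_isotropic_immersion O phi ->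
  smooth_line_map (phi_minus O phi).
Proof.
move=> tii p; have [_ [sm _] _] := tii.
have [U [psi [Up l]]] := sm p; have [c ac cp] := atlas_cover p.
have [u [U' [U'p _ l']]] := phi_minus_lift tii l ac cp Up.
by eexists; eexists; split; [exact: U'p|exact: l'].
Qed.

Lemma sdiff_mul_eq0 phi phi' U psi psi' c p w : local_lift phi U psi ->
    local_lift phi' U psi' -> (forall q, U q -> psi q ** psi' q = 0) ->
    U p -> atlas c -> cdom c p ->
  sdiff c psi p w ** psi' p + psi p ** sdiff c psi' p w = 0.
Proof.
move=> l l' pp Up ac cp; have [oU _ _] := l.
have d := lift_differentiable l ac cp Up; have d' := lift_differentiable l' ac cp Up.
have E : \forall t \near cmap c p, (psi \o cinv c) t ** (psi' \o cinv c) t = 0.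
  have := near_chart_image oU cp Up.
  by apply: filterS => _ [q [cq Uq] <-] /=; rewrite cmapK // pp.
have := diff_bilinear_eq0 w (omul_linear_l O) (omul_linear_r O) d d' E.
by rewrite /= cmapK.
Qed.

End Correspondence.

(** * From totally isotropic immersions to integral surfaces *)

Section Forward.
Context {R : realType} (O : split_octonion R) {S : smooth_surface R}.
Context (phi : S -> {vspace 'rV[R]_8}) (tii : tot_isotropic_immersion O phi).
Local Notation "x ** y" := (omul O x y) (at level 39, left associativity).

Let tii' := tot_isotropic_opp tii.

Lemma Phi_of_incidence p : incidence O (Phi_of O phi p).
Proof.
have [_ [sm _] _] := tii; have [U [psi [Up l]]] := sm p.
have [c ac cp] := atlas_cover p.
(* In the opposite algebra the lemma yields a generator of phi_+, with the products reversed. *)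
have [z [z0 zE zx zd]] := phi_minus_annihilator tii' l Up ac cp.
have [u [U' [U'p _ l']]] := phi_minus_lift tii l ac cp Up.
set Y := (X in local_lift _ _ X) in l'.
have [_ _ /(_ p U'p)[y0 yE]] := l'; have [_ _ /(_ p Up)[x0 xE]] := l.
have [y [_ yE' xy dy]] := phi_minus_annihilator tii l Up ac cp.
have /vlineP[k Yk] : Y p \in <[y]>%VS by rewrite -yE' yE memv_line.
have [yz _] := phi_minus_lift_ker tii l ac 0 cp Up l' U'p zx zd.
have -> : Phi_of O phi p = fun i => <[(if i == 0 then psi p else
    if i == 1 then Y p else z)%R]>%VS.
  apply/funext; apply: Z3_ind; rewrite /Phi_of /=; [exact: xE|exact: yE|exact: zE].
apply/incidence_line; split; apply: Z3_ind => //=.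
by rewrite Yk linearZ /= xy scaler0.
Qed.

Lemma Phi_of_smooth i : smooth_line_map ((Phi_of O phi)^~ i).
Proof.
move: i; apply: Z3_ind; rewrite /Phi_of /=.
- by have [_ [sm _] _] := tii.
- exact: phi_minus_smooth tii.
- exact: phi_minus_smooth tii'.
Qed.

Lemma Phi_of_integral : integral_surface O (Phi_of O phi).
Proof.
split; [exact: Phi_of_incidence|split; first exact: Phi_of_smooth|].
  move=> p U psi c w Up l ac cp dpsi; have [_ [_ imm] _] := tii.
  exact: (imm p U (psi 0) c w Up (l 0) ac cp (dpsi 0)).
move=> p U psi c w Up l ac cp.
have inc q : U q -> incidence O (fun i => <[psi i q]>%VS).
  move=> Uq; have -> : (fun i => <[psi i q]>%VS) = Phi_of O phi q.
    by apply/funext => i; have [_ _ /(_ q Uq)[_ <-]] := l i.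
  exact: Phi_of_incidence.
have mul0 i q : U q -> psi i q ** psi (i + 1) q = 0.
  by move=> /inc/incidence_line[_]; apply.
have dmul i := sdiff_mul_eq0 w (l i) (l (i + 1)) (mul0 i) Up ac cp.
have [z [z0 zE zx zd]] := phi_minus_annihilator tii' (l 0) Up ac cp.
have [y [y0 yE xy dy]] := phi_minus_annihilator tii (l 0) Up ac cp.
have /vlineP[k yk] : psi 1 p \in <[y]>%VS.
  by rewrite -yE; have [_ _ /(_ p Up)[_ E]] := l 1; rewrite [phi_minus _ _ _]E memv_line.
have /vlineP[k' zk] : psi (1 + 1) p \in <[z]>%VS.
  by rewrite -zE; have [_ _ /(_ p Up)[_ E]] := l (1 + 1);
    rewrite [phi_minus _ _ _]E memv_line.
have [_ dyz] := phi_minus_lift_ker tii (l 0) ac w cp Up (l 1) Up zx zd.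
(* Index 0 holds because phi_- annihilates V, index 1 by [phi_minus_lift_ker]. At index 2 phi_+
   kills the right product, and the derivative of the incidence relation then kills the left one. *)
have left0 i : sdiff c (psi i) p w ** psi (i + 1) p = 0.
  move: i; apply: Z3_ind.
  - by rewrite add0r yk linearZ /= dy scaler0.
  - by rewrite zk linearZ /= dyz scaler0.
  - have := dmul (1 + 1); have -> : 1 + 1 + 1 = 0 :> 'Z_3 by apply: val_inj.
    have /= zd' := zd w; by rewrite zk omulZl zd' scaler0 addr0.
apply/xiP; first exact: inc.
by move=> i; split=> //; have := dmul i; rewrite left0 add0r.
Qed.

End Forward.

(** * From integral surfaces to totally isotropic immersions *)

Section Backward.
Context {R : realType} (O : split_octonion R) {S : smooth_surface R}.
Context (Phi : S -> 'Z_3 -> {vspace 'rV[R]_8}) (integral : integral_surface O Phi)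
  (imm : immersion (q_proj 0 \o Phi)).
Local Notation "x ** y" := (omul O x y) (at level 39, left associativity).

Lemma common_lift p : exists U (psi : 'Z_3 -> S -> 'rV[R]_8),
  U p /\ forall i, local_lift (Phi^~ i) U (psi i).
Proof.
have [_ [sm _] _] := integral.
have [U0 [psi0 [U0p l0]]] := sm 0 p; have [U1 [psi1 [U1p l1]]] := sm 1 p.
have [U2 [psi2 [U2p l2]]] := sm (1 + 1) p.
have [oU0 _ _] := l0; have [oU1 _ _] := l1; have [oU2 _ _] := l2.
have oU : open (U0 `&` U1 `&` U2) by do 2 apply: openI => //.
exists (U0 `&` U1 `&` U2).
exists (fun i => if i == 0 then psi0 else if i == 1 then psi1 else psi2).
split=> //; apply: Z3_ind => /=.
- by apply: local_lift_sub l0 => // q [[]].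
- by apply: local_lift_sub l1 => // q [[]].
- by apply: local_lift_sub l2 => // q [].
Qed.

(** The conditions of [xiP] at [i = 0] and [i = 1 + 1]. *)
Lemma integral_annihilator p U (psi : 'Z_3 -> S -> 'rV[R]_8) c w :
    U p -> (forall i, local_lift (Phi^~ i) U (psi i)) -> atlas c -> cdom c p ->
  [/\ psi 0 p ** psi 1 p = 0, psi (1 + 1) p ** psi 0 p = 0,
      sdiff c (psi 0) p w ** psi 1 p = 0 &
      psi (1 + 1) p ** sdiff c (psi 0) p w = 0].
Proof.
move=> Up l ac cp; have [incP _ tan] := integral.
have inc : incidence O (fun i => <[psi i p]>%VS).
  have -> : (fun i => <[psi i p]>%VS) = Phi p; last exact: incP.
  by apply/funext => i; have [_ _ /(_ p Up)[_ <-]] := l i.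
have /incidence_line[_ xx] := inc.
have vx := (xiP _ inc).1 (tan p U psi c w Up l ac cp).
have E2 : 1 + 1 + 1 = 0 :> 'Z_3 by apply: val_inj.
have := xx 0; have := xx (1 + 1); have [v01 _] := vx 0; have [_ v20] := vx (1 + 1).
by rewrite E2 in v20 *; rewrite add0r in v01 *.
Qed.

(** Every vector of V annihilates the nonzero vector [psi' 1 p] from the left, hence has norm
    zero. *)
Lemma integral_tot_isotropic : tot_isotropic_immersion O (q_proj 0 \o Phi).
Proof.
split=> // [p|U psi p l Up v].
  by have [/(_ p)[/(_ 0)]] := integral.
have [U' [psi' [U'p l']]] := common_lift p; have [c ac cp] := atlas_cover p.
case/(lift_spaceP (l' 0) l U'p Up ac cp) => a [w ->].
have [xy _ dy _] := integral_annihilator w U'p l' ac cp.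
have [_ _ /(_ p U'p)[y0 _]] := l' 1.
apply: (@onorm_mul0l _ O _ (psi' 1 p)) => //.
by rewrite omulDl omulZl xy dy scaler0 addr0.
Qed.

(** The components 1 and 2 annihilate V on the proper sides, so [phi_minus_eq], in the algebra and
    in its opposite, identifies them. *)
Lemma Phi_of_q_proj : Phi_of O (q_proj 0 \o Phi) = Phi.
Proof.
have tii := integral_tot_isotropic; have tii' := tot_isotropic_opp tii.
apply/funext => p; apply/funext.
have [U [psi [Up l]]] := common_lift p; have [c ac cp] := atlas_cover p.
have ann w := integral_annihilator w Up l ac cp.
have [xy zx _ _] := ann 0.
apply: Z3_ind; rewrite /Phi_of //=.
- have [_ _ /(_ p Up)[y0 ->]] := l 1.
  by apply: (phi_minus_eq tii (l 0) Up ac cp) => // w; case: (ann w).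
- have [_ _ /(_ p Up)[z0 ->]] := l (1 + 1).
  by apply: (phi_minus_eq tii' (l 0) Up ac cp) => // w; case: (ann w).
Qed.

End Backward.

Theorem proposition19 (R : realType) (O : split_octonion R)
    (S : smooth_surface R) :
  set_bij (@tot_isotropic_immersion R O S)
          [set Phi | @integral_surface R O S Phi /\ immersion (q_proj 0 \o Phi)]
          (@Phi_of R O S) /\
  (forall phi, @tot_isotropic_immersion R O S phi ->
     q_proj 0 \o Phi_of O phi = phi) /\
  (forall Phi, @integral_surface R O S Phi -> immersion (q_proj 0 \o Phi) ->
     @tot_isotropic_immersion R O S (q_proj 0 \o Phi) /\
     Phi_of O (q_proj 0 \o Phi) = Phi).
Proof.
(* True by computation; it gives both the left inverse and injectivity. *)
have q_Phi phi : q_proj 0 \o Phi_of O phi = phi :> (S -> _) by [].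
split; last first.
  split=> // Phi iPhi imm; split; first exact: integral_tot_isotropic.
  exact: Phi_of_q_proj.
split.
- move=> phi tii; split; first exact: Phi_of_integral.
  by rewrite q_Phi; case: tii.
- by move=> phi phi' _ _ E; rewrite -(q_Phi phi) E q_Phi.
- move=> Phi [iPhi imm]; exists (q_proj 0 \o Phi).
    exact: integral_tot_isotropic.
  exact: Phi_of_q_proj.
Qed.
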